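(* For $\beta\in{}_M\mathcal X_M^\alpha$, an isometry $T\in\mathrm{Hom}(\beta,\alpha^+_\nu\alpha^-_{\nu'})$ with $\nu,\nu'\in{}_N\mathcal X_N$, and $\lambda\in\Sigma({}_N\mathcal X_N)$, put $\mathcal E^\pm_\lambda(\beta)=T^*\varepsilon^\pm(\lambda,\nu\nu')\,\alpha^\pm_\lambda(T)$. The operators $\mathcal E^\pm_\lambda(\beta)$ are independent of the choice of $T$ and $\nu,\nu'$ in the sense that, if $\xi,\xi'\in{}_N\mathcal X_N$ and $S\in\mathrm{Hom}(\beta,\alpha^+_\xi\alpha^-_{\xi'})$ is an isometry, then $\mathcal E^\pm_\lambda(\beta)=S^*\varepsilon^\pm(\lambda,\xi\xi')\,\alpha^\pm_\lambda(S)$. Moreover, for each $\lambda\in\Sigma({}_N\mathcal X_N)$, the family $\{\mathcal E^\pm_\lambda(\beta)\}_{\beta\in\Phi}$ is a half-braiding for the morphism $\alpha^\pm_\lambda$ with respect to the system $\Phi={}_M\mathcal X_M^\alpha$.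
   Context: Conventions. All factors are type III von Neumann factors and all morphisms have finite statistical dimension. A $B$-$A$ morphism is a unital $*$-homomorphism $\rho:A\to B$; $d_\rho=[B:\rho(A)]^{1/2}$ (minimal index). $\mathrm{Hom}(\rho,\sigma)=\{t\in B:\ t\rho(a)=\sigma(a)t\ \forall a\in A\}$. A conjugate of $\rho$ is $\bar\rho:B\to A$ admitting isometries $r_\rho\in\mathrm{Hom}(\mathrm{id}_A,\bar\rho\rho)$, $\bar r_\rho\in\mathrm{Hom}(\mathrm{id}_B,\rho\bar\rho)$ with $\rho(r_\rho)^*\bar r_\rho=d_\rho^{-1}\mathbf 1$, $\bar\rho(\bar r_\rho)^*r_\rho=d_\rho^{-1}\mathbf 1$. The sector $[\rho]$ is the unitary equivalence class; $[\sigma]$ is a subsector of $[\rho]$ if $\mathrm{Hom}(\sigma,\rho)$ contains an isometry; sums of morphisms are $\sum_i t_i\rho_i(\cdot)t_i^*$ with isometries $t_i$ satisfying the Cuntz relations. A finite system $\Delta\subset\mathrm{End}(A)$ is a finite set of irreducible, pairwise inequivalent endomorphisms containing $\mathrm{id}$ and closed, up to unitary equivalence, under conjugates and under decomposition of products into irreducibles. $\Sigma(\Delta)$ is the set of finite sums of morphisms in $\Delta$. Braiding. $\Delta$ is braided if there are unitaries $\varepsilon(\lambda,\mu)\in\mathrm{Hom}(\lambda\mu,\mu\lambda)$, $\lambda,\mu\in\Delta$, with $\varepsilon(\mathrm{id},\mu)=\varepsilon(\lambda,\mathrm{id})=\mathbf 1$ and, for all $t\in\mathrm{Hom}(\lambda,\mu\nu)$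 and $\rho\in\Delta$, $\rho(t)\varepsilon(\lambda,\rho)=\varepsilon(\mu,\rho)\mu(\varepsilon(\nu,\rho))t$ and $t\varepsilon(\rho,\lambda)=\mu(\varepsilon(\rho,\nu))\varepsilon(\rho,\mu)\rho(t)$, together with $\rho(t)^*\varepsilon(\mu,\rho)\mu(\varepsilon(\nu,\rho))=\varepsilon(\lambda,\rho)t^*$ and $t^*\mu(\varepsilon(\rho,\nu))\varepsilon(\rho,\mu)=\varepsilon(\rho,\lambda)\rho(t)^*$. It extends to $\Sigma(\Delta)$ by $\varepsilon(\lambda,\mu)=\sum_{i,j}s_j\mu_j(t_i)\varepsilon(\lambda_i,\mu_j)\lambda_i(s_j)^*t_i^*$ for $\lambda=\sum_i t_i\lambda_i(\cdot)t_i^*$, $\mu=\sum_j s_j\mu_j(\cdot)s_j^*$. $\varepsilon^+=\varepsilon$, $\varepsilon^-(\lambda,\mu)=\varepsilon(\mu,\lambda)^*$. Standing assumption. $N\subset M$ is a type III subfactor, $\iota:N\hookrightarrow M$ the inclusion, $\bar\iota:M\to N$ a conjugate, $\theta=\bar\iota\iota$. ${}_N\mathcal X_N\subset\mathrm{End}(N)$ is a finite braided system, ${}_N\mathcal Y_N\subset{}_N\mathcal X_N$ a subsystem, and $\theta\in\Sigma({}_N\mathcal Y_N)$. For $\lambda\in\Sigma({}_N\mathcal X_N)$, $\alpha^\pm_\lambda=\bar\iota^{\,-1}\circ\mathrm{Ad}(\varepsilon^\pm(\lambda,\theta))\circ\lambda\circ\bar\iota\in\mathrm{End}(M)$ (well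 defined; extends $\lambda$). ${}_M\mathcal X_M\subset\mathrm{End}(M)$ is a choice of representatives (with $\mathrm{id}$ for the trivial sector) of all irreducible subsectors of $[\iota\lambda\bar\iota]$, $\lambda\in{}_N\mathcal X_N$; ${}_M\mathcal X_M^\alpha$ is the subsystem of $\beta\in{}_M\mathcal X_M$ with $[\beta]$ a subsector of $[\alpha^+_\lambda\alpha^-_\mu]$ for some $\lambda,\mu\in{}_N\mathcal X_N$ (so isometries $T$ as in the claim exist by definition). Half-braiding. For a system $\Phi\subset\mathrm{End}(M)$, a half-braiding of $\sigma\in\Sigma(\Phi)$ with respect to $\Phi$ is a family of unitaries $\{\mathcal E_\sigma(\beta)\}_{\beta\in\Phi}$ with (1) $\mathcal E_\sigma(\beta)\in\mathrm{Hom}(\sigma\beta,\beta\sigma)$ for all $\beta\in\Phi$, and (2) $X\mathcal E_\sigma(\beta_3)=\beta_1(\mathcal E_\sigma(\beta_2))\mathcal E_\sigma(\beta_1)\sigma(X)$ for all $\beta_1,\beta_2,\beta_3\in\Phi$ and $X\in\mathrm{Hom}(\beta_3,\beta_1\beta_2)$. *)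

(* Defs.v *)
From HB Require Import structures.
From mathcomp Require Import all_boot all_order all_algebra.
From mathcomp Require Import sesquilinear complex.
From mathcomp Require Import all_classical all_reals all_analysis.

Set Implicit Arguments.
Unset Strict Implicit.
Unset Printing Implicit Defensive.

Import Order.TTheory GRing.Theory Num.Theory.
Import numFieldNormedType.Exports.

Local Open Scope classical_set_scope.
Local Open Scope complex_scope.
Local Open Scope ring_scope.

Reserved Notation "T ^†" (at level 1, format "T ^†").

Record hilbertSpace (R : realType) := HilbertSpace {
  hilbert_sort :> completeNormedModType R[i];
  inner : {dot hilbert_sort for Num.conj};
  inner_norm : forall x : hilbert_sort, `|x| ^+ 2 = inner x x }.

Section BoundedOperators.
Context {R : realType} (H : hilbertSpace R).

Definition bounded_pred : {pred H -> H} :=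
  [pred f : H -> H | `[< linear f /\ continuous f >]].

Lemma bounded_predP f : reflect (linear f /\ continuous f) (f \in bounded_pred).
Proof. exact: asboolP. Qed.

Record bop := Bop { bop_fun :> H -> H; bop_funP : bop_fun \in bounded_pred }.

HB.instance Definition _ := [isSub for bop_fun].
HB.instance Definition _ := [Choice of bop by <:].

Lemma bounded_submod_closed : submod_closed bounded_pred.
Proof.
split=> [|c f g /bounded_predP[lf cf] /bounded_predP[lg cg]].
  apply/bounded_predP; split=> [a x y|]; first by rewrite /= scaler0 addr0.
  exact: cst_continuous.
apply/bounded_predP; split=> [a x y|x].
  by rewrite !fctE lf lg !scalerDr !scalerA (mulrC c a) addrACA.
apply: (@continuousD _ _ _ (c *: f) g x); last exact: cg.
by apply: continuousZr; exact: cf.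
Qed.

HB.instance Definition _ :=
  GRing.isSubmodClosed.Build R[i] (H -> H) bounded_pred bounded_submod_closed.
HB.instance Definition _ := [SubChoice_isSubLmodule of bop by <:].

Lemma bop_linear (T : bop) : linear T.
Proof. by case/bounded_predP: (bop_funP T). Qed.

Lemma bop_continuous (T : bop) : continuous T.
Proof. by case/bounded_predP: (bop_funP T). Qed.

Fact bop1_subproof : id \in bounded_pred.
Proof. by apply/bounded_predP; split=> // x. Qed.

Fact bopM_subproof (S T : bop) : S \o T \in bounded_pred.
Proof.
apply/bounded_predP; split=> [a x y|x].
  by rewrite /= !bop_linear.
by apply: continuous_comp; apply: bop_continuous.
Qed.

Definition bop1 : bop := Bop bop1_subproof.
Definition bopM (S T : bop) : bop := Bop (bopM_subproof S T).

Fact bopMA : associative bopM.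
Proof. by move=> S T U; apply: val_inj. Qed.
Fact bop1M : left_id bop1 bopM.
Proof. by move=> T; apply: val_inj. Qed.
Fact bopM1 : right_id bop1 bopM.
Proof. by move=> T; apply: val_inj. Qed.
Fact bopMDl : left_distributive bopM +%R.
Proof. by move=> S T U; apply: val_inj. Qed.
Fact bopMDr : right_distributive bopM +%R.
Proof.
move=> S T U; apply: val_inj; apply/funext => x /=.
by rewrite !fctE -[T x]scale1r bop_linear !scale1r.
Qed.

HB.instance Definition _ := GRing.Zmodule_isPzRing.Build bop
  bopMA bop1M bopM1 bopMDl bopMDr.
End BoundedOperators.

Section OperatorAlgebras.
Context {R : realType} {H : hilbertSpace R}.
Implicit Types (S T p v x : bop H) (A B P : set (bop H)).

Definition scalar_op (c : R[i]) : bop H := c *: (1 : bop H).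

Definition is_adjoint T S :=
  forall x y : H, inner H (T x) y = inner H x (S y).

Definition adj T : bop H := xget 0 [set S | is_adjoint T S].

Local Notation "T ^†" := (adj T).

Definition commutant A : set (bop H) :=
  [set S | forall T, A T -> S * T = T * S].

Definition von_neumann_algebra A :=
  (forall T, A T -> exists2 S, A S & is_adjoint T S) /\
  commutant (commutant A) = A.

Definition factor A :=
  [/\ von_neumann_algebra A, (1 : bop H) <> 0 &
      A `&` commutant A = [set T | exists c : R[i], T = scalar_op c]].

Definition projection_in A p := [/\ A p, p^† = p & p * p = p].

(* For projections, [q <= p] is expressed by [p * q = q]. *)
Definition finite_projection A p :=
  projection_in A p /\
  (forall v, A v -> v^† * v = p -> p * (v * v^†) = v * v^† -> v * v^† = p).

Definition type_III_factor A :=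
  factor A /\ (forall p, finite_projection A p -> p = 0).

Definition op_le S T :=
  forall x : H, 0 <= inner H ((T - S) x) x.

(* A morphism between algebras of operators is a map [bop H -> bop H] of which
   only the values on the source algebra are meaningful. *)
Definition endo := bop H -> bop H.

Implicit Types (rho sigma lam mu nu beta : endo).

Definition star_hom A B rho :=
  (forall a, A a -> B (rho a)) /\
  [/\ forall (c : R[i]) a b, A a -> A b -> rho (c *: a + b) = c *: rho a + rho b,
      forall a b, A a -> A b -> rho (a * b) = rho a * rho b,
      rho 1 = 1 &
      forall a, A a -> rho (a^†) = (rho a)^†].

Definition is_lub B (D : set (bop H)) x :=
  [/\ B x, forall y, D y -> op_le y x &
      forall z, B z -> (forall y, D y -> op_le y z) -> op_le x z].

Definition directed (D : set (bop H)) :=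
  D !=set0 /\
  (forall x y, D x -> D y -> exists z, [/\ D z, op_le x z & op_le y z]).

Definition normal_map B (E : endo) :=
  forall (D : set (bop H)) x,
    (forall y, D y -> B y /\ op_le 0 y) -> directed D -> is_lub B D x ->
    is_lub B (E @` D) (E x).

Definition conditional_expectation B P (E : endo) :=
  (forall x, B x -> P (E x)) /\
  [/\ forall (c : R[i]) x y, B x -> B y -> E (c *: x + y) = c *: E x + E y,
      forall a x b, P a -> B x -> P b -> E (a * x * b) = a * E x * b,
      E 1 = 1,
      forall x, B x -> op_le 0 x -> op_le 0 (E x) &
      normal_map B E].

(* Pimsner-Popa: for infinite factors, the index of a normal conditional
   expectation E is the inverse of the best constant c with E x >= c x for all
   x >= 0.  The minimal index is the infimum over E, i.e. the inverse of the
   supremum of the constants below; it is finite when this set is nonempty.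
   The inequality forces E to be faithful. *)
Definition pimsner_popa_constants B P : set R :=
  [set c | 0 < c /\ exists E, conditional_expectation B P E /\
     forall x, B x -> op_le 0 x -> op_le (c%:C *: x) (E x)].

Definition minimal_index B P : R := (sup (pimsner_popa_constants B P))^-1.

Definition statistical_dim A B rho : R := Num.sqrt (minimal_index B (rho @` A)).

Definition morphism A B rho :=
  star_hom A B rho /\ pimsner_popa_constants B (rho @` A) !=set0.

Definition Hom A B rho sigma : set (bop H) :=
  [set t | B t /\ forall a, A a -> t * rho a = sigma a * t].

Definition isometry_op T := T^† * T = 1.

Definition unitary_op T := T^† * T = 1 /\ T * T^† = 1.

Definition conjugate A B rho (rhob : endo) :=
  morphism B A rhob /\
  exists r rb,
    [/\ Hom A A id (rhob \o rho) r /\ isometry_op r,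
        Hom B B id (rho \o rhob) rb /\ isometry_op rb,
        (rho r)^† * rb = scalar_op ((statistical_dim A B rho)^-1)%:C &
        (rhob rb)^† * r = scalar_op ((statistical_dim A B rho)^-1)%:C].

Definition equivalent A B rho sigma :=
  exists2 u, Hom A B rho sigma u & unitary_op u.

Definition subsector A B sigma rho :=
  exists2 t, Hom A B sigma rho t & isometry_op t.

Definition irreducible A B rho :=
  Hom A B rho rho = [set t | exists c : R[i], t = scalar_op c].

Definition is_sum A n (t : 'I_n -> bop H) (rho : 'I_n -> endo) sigma :=
  [/\ forall i, A (t i),
      forall i j, (t i)^† * t j = (i == j)%:R,
      \sum_i t i * (t i)^† = 1 &
      forall a, A a -> sigma a = \sum_i t i * rho i a * (t i)^†].

Definition Sigma A (D : set endo) : set endo :=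
  [set sigma | exists n (t : 'I_n -> bop H) (rho : 'I_n -> endo),
     (forall i, D (rho i)) /\ is_sum A t rho sigma].

Definition finite_system A (D : set endo) :=
  [/\ finite_set D,
      forall rho, D rho -> morphism A A rho /\ irreducible A A rho,
      forall rho sigma, D rho -> D sigma -> equivalent A A rho sigma ->
        rho = sigma &
      [/\ D id,
          forall rho, D rho -> exists rhob, conjugate A A rho rhob /\
            exists2 sigma, D sigma & equivalent A A rhob sigma &
          forall rho sigma, D rho -> D sigma -> Sigma A D (rho \o sigma)]].

Definition braiding A (D : set endo) (eps : endo -> endo -> bop H) :=
  [/\ forall lam mu, D lam -> D mu ->
        Hom A A (lam \o mu) (mu \o lam) (eps lam mu) /\ unitary_op (eps lam mu),
      forall mu, D mu -> eps id mu = 1,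
      forall lam, D lam -> eps lam id = 1 &
      forall lam mu nu rho t, D lam -> D mu -> D nu -> D rho ->
        Hom A A lam (mu \o nu) t ->
        [/\ rho t * eps lam rho = eps mu rho * mu (eps nu rho) * t,
            t * eps rho lam = mu (eps rho nu) * eps rho mu * rho t,
            (rho t)^† * eps mu rho * mu (eps nu rho) = eps lam rho * t^† &
            t^† * mu (eps rho nu) * eps rho mu = eps rho lam * (rho t)^†]].

(* For a braiding, the set below is a singleton when lam and mu are in
   [Sigma A D]: the value does not depend on the chosen decompositions. *)
Definition braiding_ext A (D : set endo) (eps : endo -> endo -> bop H)
    lam mu : bop H :=
  xget 0 [set u |
    exists n (t : 'I_n -> bop H) (rho : 'I_n -> endo)
           m (s : 'I_m -> bop H) (tau : 'I_m -> endo),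
      [/\ forall i, D (rho i), forall j, D (tau j),
          is_sum A t rho lam, is_sum A s tau mu &
          u = \sum_i \sum_j s j * tau j (t i) * eps (rho i) (tau j)
                * (rho i (s j))^† * (t i)^†]].

(* [b = true] stands for the sign +, [b = false] for the sign -. *)
Definition braiding_pm A (D : set endo) (eps : endo -> endo -> bop H)
    (b : bool) lam mu : bop H :=
  if b then braiding_ext A D eps lam mu else (braiding_ext A D eps mu lam)^†.

Section AlphaInduction.
(* N and M act on the same Hilbert space, so that the inclusion N c M is the
   identity on operators. *)
Variables (N M : set (bop H)) (iotab : endo) (X : set endo).
Variable eps : endo -> endo -> bop H.

Definition iotaNM : endo := id.

Definition theta : endo := iotab \o iotaNM.

(* iotab is injective, so that the set below has at most one element. *)
Definition alpha (b : bool) lam : endo := fun m =>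
  let u := braiding_pm N X eps b lam theta in
  xget 0 [set x | M x /\ iotab x = u * lam (iotab m) * u^†].

Definition MM_representatives (XM : set endo) :=
  [/\ forall beta, XM beta -> morphism M M beta /\ irreducible M M beta,
      forall beta beta', XM beta -> XM beta' -> equivalent M M beta beta' ->
        beta = beta',
      XM id,
      forall beta, XM beta ->
        exists2 lam, X lam & subsector M M beta (iotaNM \o lam \o iotab) &
      (* Every finite-index morphism is a finite sum of irreducible ones, hence
         the second conjunct once all irreducible subsectors are represented. *)
      forall lam, X lam ->
        (forall sigma, morphism M M sigma -> irreducible M M sigma ->
           subsector M M sigma (iotaNM \o lam \o iotab) ->
           exists2 beta, XM beta & equivalent M M sigma beta) /\
        Sigma M XM (iotaNM \o lam \o iotab)].

Definition MM_alpha (XM : set endo) : set endo :=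
  [set beta | XM beta /\ exists lam mu, [/\ X lam, X mu &
     subsector M M beta (alpha true lam \o alpha false mu)]].

Definition alpha_isometry beta nu nu' T :=
  [/\ X nu, X nu', Hom M M beta (alpha true nu \o alpha false nu') T &
      isometry_op T].

Definition half_braid_op (b : bool) lam nu nu' T : bop H :=
  T^† * braiding_pm N X eps b lam (nu \o nu') * alpha b lam T.

Definition half_braid_family (b : bool) lam beta : bop H :=
  xget 0 [set u | exists nu nu' T,
    alpha_isometry beta nu nu' T /\ u = half_braid_op b lam nu nu' T].

End AlphaInduction.

Definition half_braiding M (Phi : set endo) sigma (E : endo -> bop H) :=
  [/\ Sigma M Phi sigma,
      forall beta, Phi beta ->
        unitary_op (E beta) /\
        Hom M M (sigma \o beta) (beta \o sigma) (E beta) &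
      forall beta1 beta2 beta3 Y, Phi beta1 -> Phi beta2 -> Phi beta3 ->
        Hom M M beta3 (beta1 \o beta2) Y ->
        Y * E beta3 = beta1 (E beta2) * E beta1 * sigma Y].

End OperatorAlgebras.

Arguments endo {R} H.

Notation "T ^†" := (adj T) : ring_scope.

(* Main.v *)
From mathcomp Require Import all_boot all_order all_algebra.
From mathcomp Require Import sesquilinear complex.
From mathcomp Require Import all_classical all_reals all_analysis.
Require Import Defs.

Set Implicit Arguments.
Unset Strict Implicit.
Unset Printing Implicit Defensive.

Import Order.TTheory GRing.Theory Num.Theory.

Local Open Scope classical_set_scope.
Local Open Scope ring_scope.

(* Every T in Hom(beta, alpha^+_nu alpha^-_nu') restricts on N to an intertwiner
   into iota nu nu', because alpha-induction extends nu and nu'.  So all claims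
   follow from one naturality property (alpha_nat): if Y in M satisfies
   Y mu(n) = mu'(n) Y on N, then Y eps(lam, mu) = eps(lam, mu') alpha_lam(Y).
   Applying the injective map iotab turns it into naturality of the braiding for
   iotab(Y) in Hom(theta mu, theta mu').  With v in Hom(id_M, iotab) and M = N v,
   it also gives eps(lam, nu) in Hom(alpha_lam alpha_nu, alpha_nu alpha_lam).
   That alpha_lam is a sum of elements of the system is a Gram-Schmidt argument
   inside the decompositions of iota rho iotab, which contain the alpha_rho. *)

(** * Adjoints and *-algebras of operators *)

Section Adjoint.
Context {R : realType} {H : hilbertSpace R}.
Implicit Types (S T U : bop H) (x y : H) (c : R[i]).

Lemma innerC x y : inner H x y = (inner H y x)^*.
Proof. by rewrite hermC expr0 mul1r. Qed.

Lemma inner_injr x y : (forall z, inner H z x = inner H z y) -> x = y.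
Proof.
move=> e; apply/eqP; rewrite -subr_eq0 -(dnorm_eq0 (inner H)).
by rewrite linearBr /= (e (x - y)) subrr.
Qed.

Lemma bopP S T : (forall x, S x = T x) -> S = T.
Proof. by move=> e; apply/val_inj/funext. Qed.

Lemma bop_linearB T x y : T (x - y) = T x - T y.
Proof. by rewrite -scaleN1r addrC bop_linear scaleN1r addrC. Qed.

Lemma bop_apply0 T : T 0 = 0.
Proof. by have := bop_linearB T 0 0; rewrite !subrr. Qed.

Lemma bop_applyZ T c x : T (c *: x) = c *: T x.
Proof. by rewrite -[c *: x]addr0 bop_linear bop_apply0 addr0. Qed.

Lemma bop_mulE S T x : (S * T) x = S (T x).
Proof. by []. Qed.

Lemma bop_addE S T x : (S + T) x = S x + T x.
Proof. by []. Qed.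

Lemma bop_scaleE c T x : (c *: T) x = c *: T x.
Proof. by []. Qed.

Lemma bop_scalerAl c S T : (c *: S) * T = c *: (S * T).
Proof. exact: bopP. Qed.

Lemma bop_scalerAr c S T : S * (c *: T) = c *: (S * T).
Proof. by apply: bopP => x; rewrite bop_mulE !bop_scaleE bop_applyZ. Qed.

Definition adjointable T := exists S, is_adjoint T S.

Lemma is_adjoint_inj T S U : is_adjoint T S -> is_adjoint T U -> S = U.
Proof.
by move=> TS TU; apply: bopP => y; apply: inner_injr => x; rewrite -TS -TU.
Qed.

Lemma is_adjointE T S : is_adjoint T S -> T^† = S.
Proof.
move=> TS; apply: (@is_adjoint_inj T) => //.
exact: (xgetPex 0 (ex_intro [set S | is_adjoint T S] S TS)).
Qed.

Lemma adjointableP T : adjointable T -> is_adjoint T T^†.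
Proof. by move=> [S TS]; rewrite (is_adjointE TS). Qed.

Lemma is_adjoint_sym T S : is_adjoint T S -> is_adjoint S T.
Proof. by move=> TS x y; rewrite innerC -TS -innerC. Qed.

Lemma is_adjointM T S T' S' :
  is_adjoint T T' -> is_adjoint S S' -> is_adjoint (T * S) (S' * T').
Proof. by move=> TT' SS' x y; rewrite !bop_mulE TT' SS'. Qed.

Lemma is_adjointP c T S T' S' : is_adjoint T T' -> is_adjoint S S' ->
  is_adjoint (c *: T + S) (c^* *: T' + S').
Proof.
move=> TT' SS' x y; rewrite !bop_addE !bop_scaleE.
by rewrite linearPl /= linearDr linearZr_LR /= conjCK TT' SS'.
Qed.

Lemma is_adjoint1 : is_adjoint (1 : bop H) 1.
Proof. by []. Qed.

Lemma is_adjoint0 : is_adjoint (0 : bop H) 0.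
Proof. by move=> x y; rewrite linear0l linear0r. Qed.

(** All that the algebraic part uses of von Neumann algebras. Existence of adjoints is a separate
    field because [adj] returns the default 0 on an operator without adjoint. *)
Record star_algebra (A : set (bop H)) : Prop := StarAlgebra {
  alg_adjointable T : A T -> adjointable T;
  alg_adj T : A T -> A T^†;
  alg1 : A 1;
  algM S T : A S -> A T -> A (S * T);
  algP c S T : A S -> A T -> A (c *: S + T) }.

(** Closure under products and linear combinations comes from the bicommutant: a commutant is always
    a unital algebra. *)
Lemma von_neumann_star_algebra (A : set (bop H)) :
  von_neumann_algebra A -> star_algebra A.
Proof.
move=> [Aadj AE].
have adjA T : A T -> adjointable T by move=> /Aadj[S _]; exists S.
split=> //.
- by move=> T /Aadj[S AS TS]; rewrite (is_adjointE TS).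
- by rewrite -AE => T _; rewrite mul1r mulr1.
- rewrite -{3}AE => S T; rewrite -{1 2}AE => AS AT U AU.
  by rewrite -mulrA AT // mulrA AS // mulrA.
- rewrite -{3}AE => c S T; rewrite -{1 2}AE => AS AT U AU.
  by rewrite mulrDl mulrDr bop_scalerAl bop_scalerAr AS ?AT.
Qed.

Section StarAlgebra.
Variable A : set (bop H).
Hypothesis hA : star_algebra A.

Lemma alg0 : A 0.
Proof. by rewrite -(addNr 1) -scaleN1r; apply: (algP hA); apply: alg1. Qed.

Lemma algZ c T : A T -> A (c *: T).
Proof. by move=> AT; rewrite -[_ *: _]addr0; apply: (algP hA) => //; exact: alg0. Qed.

Lemma algD S T : A S -> A T -> A (S + T).
Proof. by move=> AS AT; rewrite -[S]scale1r; apply: (algP hA). Qed.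

Lemma algB S T : A S -> A T -> A (S - T).
Proof. by move=> AS AT; rewrite addrC -scaleN1r; apply: (algP hA). Qed.

Lemma alg_sum I (s : seq I) (F : I -> bop H) :
  (forall i, A (F i)) -> A (\sum_(i <- s) F i).
Proof.
move=> AF; elim: s => [|i s IH]; first by rewrite big_nil; exact: alg0.
by rewrite big_cons; apply: algD.
Qed.

Lemma adjK T : A T -> T^†^† = T.
Proof.
by move=> AT; apply/is_adjointE/is_adjoint_sym/adjointableP/(alg_adjointable hA).
Qed.

Lemma adjM S T : A S -> A T -> (S * T)^† = T^† * S^†.
Proof.
move=> AS AT; apply: is_adjointE; apply: is_adjointM;
  exact/adjointableP/(alg_adjointable hA).
Qed.

Lemma adjP c S T : A S -> A T -> (c *: S + T)^† = c^* *: S^† + T^†.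
Proof.
move=> AS AT; apply: is_adjointE; apply: is_adjointP;
  exact/adjointableP/(alg_adjointable hA).
Qed.

Lemma adj1 : (1 : bop H)^† = 1.
Proof. exact/is_adjointE/is_adjoint1. Qed.

Lemma adj0 : (0 : bop H)^† = 0.
Proof. exact/is_adjointE/is_adjoint0. Qed.

Lemma adjZ c T : A T -> (c *: T)^† = c^* *: T^†.
Proof. by move=> AT; rewrite -[c *: T]addr0 adjP ?adj0 ?addr0 //; apply: alg0. Qed.

Lemma adjD S T : A S -> A T -> (S + T)^† = S^† + T^†.
Proof. by move=> AS AT; rewrite -[S]scale1r adjP // conjC1 !scale1r. Qed.

Lemma adj_sum I (s : seq I) (F : I -> bop H) : (forall i, A (F i)) ->
  (\sum_(i <- s) F i)^† = \sum_(i <- s) (F i)^†.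
Proof.
move=> AF; elim: s => [|i s IH]; first by rewrite !big_nil adj0.
by rewrite !big_cons adjD ?IH //; apply: alg_sum.
Qed.

End StarAlgebra.
End Adjoint.

(** * *-homomorphisms and intertwiners *)

Section StarHom.
Context {R : realType} {H : hilbertSpace R} {A B : set (bop H)}.
Hypotheses (hA : star_algebra A) (hB : star_algebra B).
Implicit Types (rho sigma tau : endo H) (S T : bop H).

Section OneHom.
Context {rho : endo H}.
Hypothesis hrho : star_hom A B rho.

Lemma shI T : A T -> B (rho T).
Proof. exact: hrho.1. Qed.

Lemma shP c S T : A S -> A T -> rho (c *: S + T) = c *: rho S + rho T.
Proof. by case: hrho => _ [+ _ _ _]; exact. Qed.

Lemma shM S T : A S -> A T -> rho (S * T) = rho S * rho T.
Proof. by case: hrho => _ [_ + _ _]; exact. Qed.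

Lemma sh1 : rho 1 = 1.
Proof. by case: hrho => _ []. Qed.

Lemma shJ T : A T -> rho T^† = (rho T)^†.
Proof. by case: hrho => _ [_ _ _ +]; exact. Qed.

Lemma shD S T : A S -> A T -> rho (S + T) = rho S + rho T.
Proof. by move=> AS AT; have := shP 1 AS AT; rewrite !scale1r. Qed.

Lemma sh0 : rho 0 = 0.
Proof. by apply: (addrI (rho 0)); rewrite -(shD (alg0 hA)) ?addr0 //; exact: alg0. Qed.

Lemma sh_sum I (s : seq I) (F : I -> bop H) : (forall i, A (F i)) ->
  rho (\sum_(i <- s) F i) = \sum_(i <- s) rho (F i).
Proof.
move=> AF; elim: s => [|i s IH]; first by rewrite !big_nil sh0.
by rewrite !big_cons shD ?IH //; apply: alg_sum.
Qed.

End OneHom.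

Lemma HomI rho sigma t : Hom A B rho sigma t -> B t.
Proof. by case. Qed.

End StarHom.

(** Membership in an algebra is decided by the shape of the term. As a hint it lets [//] close such
    goals once the facts on the morphisms and intertwiners involved are in the context, which is why
    many proofs collect them first. *)
Ltac alg_mem := first
  [ assumption
  | match goal with
    | h : Hom _ ?B _ _ ?t |- ?B ?t => exact: (HomI h)
    | h : forall i, Hom _ ?B _ _ _ |- ?B _ => exact: (HomI (h _))
    | h : forall i, ?B _ |- ?B _ => exact: h
    | h : forall i j, ?B _ |- ?B _ => exact: h
    | h : star_algebra ?B |- ?B (_ * _) => apply: (algM h); alg_mem
    | h : star_algebra ?B |- ?B (_^†) => apply: (alg_adj h); alg_mem
    | h : star_algebra ?B |- ?B 1 => exact: (alg1 h)
    | h : star_algebra ?B |- ?B 0 => exact: (alg0 h)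
    | h : star_algebra ?B |- ?B (_ - _) => apply: (algB h); alg_mem
    | h : star_algebra ?B |- ?B (_ + _) => apply: (algD h); alg_mem
    | h : star_algebra ?B |- ?B (_ *: _) => apply: (algZ h); alg_mem
    | h : star_algebra ?B |- ?B (bigop _ _ _) => apply: (alg_sum h) => ?; alg_mem
    | h : star_hom _ ?B ?f |- ?B (?f _) => apply: (shI h); alg_mem
    | h : forall i, star_hom _ ?B (?f i) |- ?B (?f _ _) => apply: (shI (h _)); alg_mem
    | |- _ ((_ \o _) _) => progress cbv beta delta [comp]; alg_mem
    | h : ?A `<=` ?B |- ?B _ => apply: h; alg_mem
    end ].

Section HomTheory.
Context {R : realType} {H : hilbertSpace R} {A B : set (bop H)}.
Hypotheses (hA : star_algebra A) (hB : star_algebra B).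
Implicit Types (rho sigma tau : endo H) (s t : bop H).
#[local] Hint Extern 0 (A _) => alg_mem : core.
#[local] Hint Extern 0 (B _) => alg_mem : core.

Lemma HomE rho sigma t a : Hom A B rho sigma t -> A a -> t * rho a = sigma a * t.
Proof. by case=> _; exact. Qed.

Lemma Hom_adj rho sigma t : star_hom A B rho -> star_hom A B sigma ->
  Hom A B rho sigma t -> Hom A B sigma rho t^†.
Proof.
move=> hr hs [Bt tE]; split=> [|a Aa]; first exact: alg_adj.
rewrite -[in LHS](adjK hA Aa) (shJ hs) // -(adjM hB) //.
by rewrite -tE // (adjM hB) // -(shJ hr) // (adjK hA).
Qed.

Lemma Hom_mul rho sigma tau s t :
  Hom A B sigma tau s -> Hom A B rho sigma t -> Hom A B rho tau (s * t).
Proof.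
move=> [Bs sE] [Bt tE]; split=> [|a Aa]; first exact: algM.
by rewrite -mulrA tE // mulrA sE // mulrA.
Qed.

Lemma Hom1 rho : Hom A B rho rho 1.
Proof. by split=> [|a _]; rewrite ?mul1r ?mulr1 //; exact: alg1. Qed.

End HomTheory.

Section StarHomComp.
Context {R : realType} {H : hilbertSpace R} {A B C : set (bop H)}.
Implicit Types (rho sigma : endo H).

Lemma star_hom_comp rho sigma :
  star_hom B C rho -> star_hom A B sigma -> star_hom A C (rho \o sigma).
Proof.
move=> hr hs; split=> [a Aa|] /=; first exact/(shI hr)/(shI hs).
split=> [c S T AS AT|S T AS AT||a Aa].
- by rewrite (shP hs) // (shP hr) //; exact: (shI hs).
- by rewrite (shM hs) // (shM hr) //; exact: (shI hs).
- by rewrite (sh1 hs) (sh1 hr).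
- by rewrite (shJ hs) // (shJ hr) //; exact: (shI hs).
Qed.

Lemma star_hom_id : star_hom A A id.
Proof. by []. Qed.

End StarHomComp.

(** * Finite direct sums of morphisms *)

Section Sums.
Context {R : realType} {H : hilbertSpace R} {A : set (bop H)}.
#[local] Hint Extern 0 (A _) => alg_mem : core.
Hypothesis hA : star_algebra A.
Context {n : nat} {t : 'I_n -> bop H} {rho : 'I_n -> endo H} {sigma : endo H}.
Hypotheses (hrho : forall i, star_hom A A (rho i)) (hs : is_sum A t rho sigma).

Lemma is_sum_mul a i : A a -> sigma a * t i = t i * rho i a.
Proof.
case: hs => At tt t1 sE Aa; rewrite sE // mulr_suml (bigD1 i) //= big1 => [|j ji].
  by rewrite -mulrA tt eqxx mulr1 addr0.
by rewrite -mulrA tt (negbTE ji) mulr0.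
Qed.

Lemma is_sum_Hom i : Hom A A (rho i) sigma (t i).
Proof. by split=> [|a Aa]; [case: hs|rewrite is_sum_mul]. Qed.

Lemma is_sum_star_hom : star_hom A A sigma.
Proof.
case: (hs) => At tt t1 sE.
have sI a : A a -> A (sigma a) by move=> Aa; rewrite sE.
split=> //; split=> [c S T AS AT|S T AS AT||a Aa].
- rewrite [LHS]sE ?(sE S) ?(sE T) //.
  rewrite scaler_sumr -big_split /=; apply: eq_bigr => i _.
  by rewrite (shP (hrho i)) // mulrDr mulrDl bop_scalerAr bop_scalerAl.
- rewrite [LHS]sE ?(sE T) // mulr_sumr; apply: eq_bigr => i _.
  by rewrite (shM (hrho i)) // !mulrA is_sum_mul.
- by rewrite sE // -[RHS]t1; apply: eq_bigr => i _; rewrite (sh1 (hrho i)) mulr1.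
- rewrite !sE // (adj_sum hA) //; apply: eq_bigr => i _.
  by rewrite (shJ (hrho i)) // !(adjM hA) ?(adjK hA) ?mulrA.
Qed.

End Sums.

(** * Braidings on sums *)

Section Braiding.
Context {R : realType} {H : hilbertSpace R} {N : set (bop H)} {X : set (endo H)}.
Hypothesis hN : star_algebra N.
Hypothesis hX : forall rho, X rho -> star_hom N N rho.
Hypothesis hXid : X id.
Implicit Types (rho sigma tau lam mu nu : endo H) (s t u : bop H).
Implicit Types (eps : endo H -> endo H -> bop H).
#[local] Hint Extern 0 (N _) => alg_mem : core.

Definition opposite eps : endo H -> endo H -> bop H := fun lam mu => (eps mu lam)^†.

Lemma braiding_in eps lam mu :
  braiding N X eps -> X lam -> X mu -> N (eps lam mu).
Proof. by move=> [he _ _ _] Xl Xm; case: (he _ _ Xl Xm) => -[]. Qed.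

(** Taking adjoints exchanges the first relation on [t] with the fourth, and the second with the
    third. *)
Lemma braiding_opposite eps : braiding N X eps -> braiding N X (opposite eps).
Proof.
move=> he; case: (he) => e1 e2 e3 e4; split=> [lam mu Xl Xm|mu Xm|lam Xl|].
- have [/(Hom_adj hN hN) h [u1 u2]] := e1 _ _ Xm Xl.
  have [hl hm] := (hX Xl, hX Xm); have Ne := braiding_in he Xm Xl.
  split; last by split; rewrite /opposite (adjK hN).
  by apply: h; [exact: star_hom_comp hm hl|exact: star_hom_comp hl hm].
- by rewrite /opposite e3 // adj1.
- by rewrite /opposite e2 // adj1.
move=> lam mu nu rho t Xl Xm Xn Xr ht; have [] := e4 _ _ _ _ _ Xl Xm Xn Xr ht.
have [[hl hm] [hn hr]] := ((hX Xl, hX Xm), (hX Xn, hX Xr)).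
have E := braiding_in he.
have Ne1 := E _ _ Xl Xr; have Ne2 := E _ _ Xr Xl; have Ne3 := E _ _ Xm Xr.
have Ne4 := E _ _ Xr Xm; have Ne5 := E _ _ Xn Xr; have Ne6 := E _ _ Xr Xn.
move=> /(congr1 (@adj _ _)) + /(congr1 (@adj _ _)) + /(congr1 (@adj _ _)) +
  /(congr1 (@adj _ _)).
rewrite !(adjM hN) // !(adjK hN) // => f1 f2 f3 f4.
by rewrite /opposite !(shJ hm) // !mulrA in f1 f2 f3 f4 *; split.
Qed.

(** Naturality is the case [nu = id] of the fusion relation, [eps id rho] being 1. *)
Lemma braiding_natl eps rho lam mu t : braiding N X eps ->
  X rho -> X lam -> X mu -> Hom N N lam mu t ->
  rho t * eps lam rho = eps mu rho * t.
Proof.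
move=> he Xr Xl Xm ht; case: (he) => _ e2 _ /(_ lam mu id rho t)[] // -> _ _ _.
by rewrite e2 // (sh1 (hX Xm)) mulr1.
Qed.

Lemma braiding_natr eps rho lam mu t : braiding N X eps ->
  X rho -> X lam -> X mu -> Hom N N lam mu t ->
  t * eps rho lam = eps rho mu * rho t.
Proof.
move=> he Xr Xl Xm ht; case: (he) => _ _ e3 /(_ lam mu id rho t)[] // _ -> _ _.
by rewrite e3 // (sh1 (hX Xm)) mul1r.
Qed.

(** The extended braiding described by its effect on intertwiners from [X]. No decomposition of
    [lam] or [mu] enters, so uniqueness and naturality can be tested on the operators
    [t * rho s]. *)
Definition is_braid eps lam mu u :=
  N u /\ forall rho tau t s, X rho -> X tau -> Hom N N rho lam t ->
    Hom N N tau mu s -> u * (t * rho s) = s * tau t * eps rho tau.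

(* [phi] allows the test to be composed with further morphisms. *)
Definition separated mu := forall (phi : endo H) (x y : bop H),
  star_hom N N phi -> (forall tau s, X tau -> Hom N N tau mu s ->
    x * phi s = y * phi s) -> x = y.

Lemma Sigma_star_hom mu : Sigma N X mu -> star_hom N N mu.
Proof.
by move=> [n [t [rho [Xr /is_sum_star_hom]]]]; apply=> // i; apply: hX.
Qed.

(** The isometries of a decomposition are admissible tests, and their range projections add up to
    1. *)
Lemma Sigma_separated mu : Sigma N X mu -> separated mu.
Proof.
move=> [n [t [rho [Xr hs]]]] phi x y hphi xy; case: (hs) => Nt _ t1 _.
have hr i := hX (Xr i).
rewrite -[x]mulr1 -[y]mulr1 -(sh1 hphi) -t1 (sh_sum hN hphi) //.
rewrite !mulr_sumr; apply: eq_bigr => i _.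
rewrite (shM hphi) // !mulrA (xy (rho i)) //.
exact: is_sum_Hom hs i.
Qed.

Lemma Sigma_base rho : X rho -> Sigma N X rho.
Proof.
move=> Xr; exists 1%N, (fun=> 1), (fun=> rho); split=> //; split=> //.
- by move=> i j; rewrite !ord1 adj1 mul1r eqxx.
- by rewrite big_ord1 adj1 mul1r.
- by move=> a _; rewrite big_ord1 adj1 mul1r mulr1.
Qed.

Definition braiding_ext_set eps lam mu := [set u |
    exists n (t : 'I_n -> bop H) (rho : 'I_n -> endo H)
           m (s : 'I_m -> bop H) (tau : 'I_m -> endo H),
      [/\ forall i, X (rho i), forall j, X (tau j),
          is_sum N t rho lam, is_sum N s tau mu &
          u = \sum_i \sum_j s j * tau j (t i) * eps (rho i) (tau j)
                * (rho i (s j))^† * (t i)^†]].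

Lemma braiding_ext_set_nonempty eps lam mu :
  Sigma N X lam -> Sigma N X mu -> exists u, braiding_ext_set eps lam mu u.
Proof.
move=> [n [t [rho [Xr hs]]]] [m [s [tau [Xt ht]]]].
by eexists; exists n, t, rho, m, s, tau; split.
Qed.

(** The operators [(t i)^† * x] and [(s j)^† * y] intertwine members of [X], so naturality of [eps]
    carries them through each summand; summing over [i] and [j] recovers [x] and [y]. *)
Lemma braiding_ext_set_is_braid eps lam mu u : braiding N X eps ->
  braiding_ext_set eps lam mu u -> is_braid eps lam mu u.
Proof.
move=> he [n [t [rho [m [s [tau [Xr Xt ht hs ->]]]]]]].
have hr i := hX (Xr i); have hta i := hX (Xt i).
have Ne i j := braiding_in he (Xr i) (Xt j).
case: (ht) (hs) => Nt _ t1 _ [Ns _ s1 _].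
split=> [|r ta x y Xr' Xt' hx hy].
  by alg_mem.
have [hr' ht'] := (hX Xr', hX Xt').
have hl : star_hom N N lam by apply: (is_sum_star_hom hN hr ht).
have hm : star_hom N N mu by apply: (is_sum_star_hom hN hta hs).
have eij i j : s j * tau j (t i) * eps (rho i) (tau j) * (rho i (s j))^† *
    (t i)^† * (x * r y) =
    (s j * (s j)^†) * y * ta (t i * (t i)^† * x) * eps r ta.
  have hxi : Hom N N r (rho i) ((t i)^† * x).
    apply: (Hom_mul hN _ hx); apply: (Hom_adj hN hN) => //.
    exact: is_sum_Hom ht i.
  have hyj : Hom N N ta (tau j) ((s j)^† * y).
    apply: (Hom_mul hN _ hy); apply: (Hom_adj hN hN) => //.
    exact: is_sum_Hom hs j.
  have := braiding_natr he (Xr i) Xt' (Xt j) hyj.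
  have := braiding_natl he Xt' Xr' (Xr i) hxi.
  rewrite (shM ht') // (shM (hr i)) // (shJ (hr i)) // => f1 f2.
  rewrite -!mulrA [(t i)^† * _]mulrA (HomE hxi) // [_ * (rho i y * _)]mulrA.
  rewrite [eps _ _ * _]mulrA -f2 -!mulrA -f1.
  rewrite (mulrA _^† y) (mulrA (tau j _)) -(HomE hyj) //.
  by rewrite !(shM ht') // !mulrA.
have -> : y * ta x * eps r ta =
    (\sum_j s j * (s j)^†) * y * ta ((\sum_i t i * (t i)^†) * x) * eps r ta.
  by rewrite t1 s1 !mul1r.
rewrite [LHS]mulr_suml [X in ta X]mulr_suml (sh_sum hN ht') // mulr_sumr.
rewrite [RHS]mulr_suml; apply: eq_bigr => i _.
rewrite !mulr_suml; apply: eq_bigr => j _.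
exact: eij.
Qed.

Lemma braiding_ext_set_opposite eps lam mu u : braiding N X eps ->
  braiding_ext_set eps lam mu u -> braiding_ext_set (opposite eps) mu lam u^†.
Proof.
move=> he [n [t [rho [m [s [tau [Xr Xt ht hs ->]]]]]]].
have hr i := hX (Xr i); have hta i := hX (Xt i).
have Ne i j := braiding_in he (Xr i) (Xt j).
case: (ht) (hs) => Nt _ _ _ [Ns _ _ _].
exists m, s, tau, n, t, rho; split=> //; rewrite exchange_big (adj_sum hN) //=.
apply: eq_bigr => j _; rewrite (adj_sum hN) //; apply: eq_bigr => i _.
by rewrite !(adjM hN) // !(adjK hN) // /opposite !mulrA.
Qed.

Lemma braid_eq lam mu (x y : bop H) : Sigma N X lam -> Sigma N X mu ->
  (forall rho tau t s, X rho -> X tau -> Hom N N rho lam t ->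
    Hom N N tau mu s -> x * (t * rho s) = y * (t * rho s)) -> x = y.
Proof.
move=> Sl Sm xy; apply: (Sigma_separated Sl (@star_hom_id _ _ N)) => rho t Xr ht.
apply: (Sigma_separated Sm (hX Xr)) => tau s Xt hs.
by rewrite -!mulrA (xy rho tau).
Qed.

Lemma is_braid_inv eps eps' lam mu u v :
  (forall rho tau, X rho -> X tau -> eps' tau rho * eps rho tau = 1) ->
  Sigma N X lam -> Sigma N X mu -> is_braid eps lam mu u ->
  is_braid eps' mu lam v -> v * u = 1.
Proof.
move=> e1 Sl Sm [_ hu] [_ hv]; apply: (braid_eq Sl Sm) => rho tau t s Xr Xt ht hs.
rewrite -mulrA (hu _ _ _ _ Xr Xt ht hs) -(mulrA s) (mulrA s) -(mulrA s) mulrA.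
by rewrite mulrA -(mulrA v) (hv _ _ _ _ Xt Xr hs ht) -mulrA e1 // mulr1 mul1r.
Qed.

(** The adjoint of a value for [eps] is a value for the opposite braiding with arguments exchanged,
    hence a two-sided inverse by [is_braid_inv]. *)
Lemma braiding_extP eps lam mu (u := braiding_ext N X eps lam mu) :
  braiding N X eps -> Sigma N X lam -> Sigma N X mu ->
  [/\ is_braid eps lam mu u, is_braid (opposite eps) mu lam u^† & unitary_op u].
Proof.
move=> he Sl Sm; have hu : braiding_ext_set eps lam mu u.
  by apply: (xgetPex 0); apply: braiding_ext_set_nonempty.
have bu := braiding_ext_set_is_braid he hu.
have bu' := braiding_ext_set_is_braid (braiding_opposite he)
  (braiding_ext_set_opposite he hu).
have [e1 _ _ _] := he; split=> //; split.
  apply: (is_braid_inv _ Sl Sm bu bu') => rho tau Xr Xt.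
  by have [_ []] := e1 _ _ Xr Xt.
apply: (is_braid_inv _ Sm Sl bu' bu) => rho tau Xr Xt.
by have [_ []] := e1 _ _ Xt Xr.
Qed.

Lemma is_braid_Hom eps lam mu u : braiding N X eps ->
  Sigma N X lam -> Sigma N X mu -> is_braid eps lam mu u ->
  Hom N N (lam \o mu) (mu \o lam) u.
Proof.
move=> he Sl Sm [Nu hu]; split=> // a Na /=.
have [hl hm] := (Sigma_star_hom Sl, Sigma_star_hom Sm).
apply: (braid_eq Sl Sm) => rho tau t s Xr Xt ht hs.
have [[hr hta] [Nt Ns]] := ((hX Xr, hX Xt), (HomI ht, HomI hs)).
have [e1 _ _ _] := he; have [eh _] := e1 _ _ Xr Xt.
rewrite -[LHS]mulrA (mulrA (lam _)) -(HomE ht) // -(mulrA t) -(shM hr) //.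
rewrite -(HomE hs) // (shM hr) // (mulrA t) mulrA (hu _ _ _ _ Xr Xt ht hs).
rewrite -[LHS]mulrA (HomE eh) //= mulrA -[RHS]mulrA (hu _ _ _ _ Xr Xt ht hs).
rewrite -(mulrA s) -(shM hta) // (HomE ht) // (shM hta) // !mulrA.
by rewrite (HomE hs) //; alg_mem.
Qed.

Lemma is_braid_natl eps lam lam' mu u u' t :
  Sigma N X lam -> Sigma N X lam' -> Sigma N X mu ->
  is_braid eps lam mu u -> is_braid eps lam' mu u' -> Hom N N lam lam' t ->
  u' * t = mu t * u.
Proof.
move=> Sl Sl' Sm [_ hu] [_ hu'] ht; have Nt := HomI ht; have hm := Sigma_star_hom Sm.
apply: (braid_eq Sl Sm) => rho tau r s Xr Xt hr hs.
have [Nr htau] := (HomI hr, hX Xt).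
rewrite -mulrA (mulrA t) (hu' _ _ _ _ Xr Xt (Hom_mul hN ht hr) hs) -[RHS]mulrA.
by rewrite (hu _ _ _ _ Xr Xt hr hs) (shM htau) // !mulrA (HomE hs).
Qed.

Definition signed_braiding (b : bool) eps := if b then eps else opposite eps.

Lemma signed_braidingP b eps : braiding N X eps -> braiding N X (signed_braiding b eps).
Proof. by case: b => // /braiding_opposite. Qed.

Lemma braiding_pmP b eps lam mu : braiding N X eps ->
  Sigma N X lam -> Sigma N X mu ->
  is_braid (signed_braiding b eps) lam mu (braiding_pm N X eps b lam mu) /\
  unitary_op (braiding_pm N X eps b lam mu).
Proof.
move=> he Sl Sm; case: b => /=; first by case: (braiding_extP he Sl Sm).
have [[Nu _] ? [u1 u2]] := braiding_extP he Sm Sl.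
by split=> //; split; rewrite (adjK hN).
Qed.

(** * Moving a fixed sum [lam] across other morphisms *)

Section Crossing.
Context {eps : endo H -> endo H -> bop H} {lam : endo H} {E : endo H -> bop H}.
Hypotheses (he : braiding N X eps) (Sl : Sigma N X lam).
Hypothesis hE : forall mu, Sigma N X mu ->
  is_braid eps lam mu (E mu) /\ unitary_op (E mu).

(** [U] plays the role of the braiding of [lam] with [mu]. These properties survive composition, so
    that [theta \o mu] can be crossed without exhibiting it as a sum. *)
Record crossing mu U : Prop := Crossing {
  crossing_hom : star_hom N N mu;
  crossing_in : N U;
  crossing_unitary : unitary_op U;
  crossing_separated : separated mu;
  crossingE : forall tau s, X tau -> Hom N N tau mu s -> U * lam s = s * E tau }.

Let hlam : star_hom N N lam := Sigma_star_hom Sl.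

Lemma braid_base rho tau t : X rho -> X tau -> Hom N N rho lam t ->
  E tau * t = tau t * eps rho tau.
Proof.
move=> Xr Xt ht; have [[_ h] _] := hE (Sigma_base Xt).
by have := h _ _ _ _ Xr Xt ht (Hom1 hN tau); rewrite (sh1 (hX Xr)) mulr1 mul1r.
Qed.

Lemma braid_base_in tau : X tau -> N (E tau).
Proof. by move=> Xt; have [[]] := hE (Sigma_base Xt). Qed.

Lemma Sigma_crossing mu : Sigma N X mu -> crossing mu (E mu).
Proof.
move=> Sm; have [[NE hEm] uE] := hE Sm; split=> //.
- exact: Sigma_star_hom.
- exact: Sigma_separated.
move=> tau s Xt hs; apply: (Sigma_separated Sl (@star_hom_id _ _ N)) => rho t Xr ht /=.
have Ns := HomI hs; rewrite -[in LHS]mulrA -(HomE ht) // (hEm _ _ _ _ Xr Xt ht hs).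
by rewrite -[RHS]mulrA (braid_base Xr Xt ht) mulrA.
Qed.

(* The braiding fusion equation, with [lam] a sum of elements of [X]. *)
Lemma braid_fusion sigma mu nu t : X sigma -> X mu -> X nu ->
  Hom N N sigma (mu \o nu) t -> t * E sigma = mu (E nu) * E mu * lam t.
Proof.
move=> Xs Xm Xn ht; have [hm hn] := (hX Xm, hX Xn); have Nt := HomI ht.
have NE := braid_base_in Xn.
apply: (Sigma_separated Sl (@star_hom_id _ _ N)) => rho r Xr hr /=.
have Nr := HomI hr; have hrho := hX Xr.
have Ne := braiding_in he Xr Xn.
have [_ _ _ /(_ _ _ _ _ _ Xs Xm Xn Xr ht)[_ e2 _ _]] := he.
rewrite -[LHS]mulrA (braid_base Xr Xs hr) mulrA (HomE ht) //= -mulrA e2 !mulrA.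
rewrite -[RHS]mulrA -(HomE hr) // mulrA -[_ * E mu * r]mulrA (braid_base Xr Xm hr).
by rewrite mulrA -[in RHS](shM hm) // (braid_base Xr Xn hr) (shM hm) // !mulrA.
Qed.

Lemma crossing_nat mu U mu' U' Y : crossing mu U -> crossing mu' U' ->
  Hom N N mu mu' Y -> Y * U = U' * lam Y.
Proof.
move=> [hm NU _ sm hU] [hm' NU' _ _ hU'] hY; have NY := HomI hY.
apply: (sm lam _ _ hlam) => tau s Xt hs; have Ns := HomI hs.
rewrite -mulrA (hU _ _ Xt hs) -[RHS]mulrA -(shM hlam) //.
by rewrite (hU' _ _ Xt (Hom_mul hN hY hs)) mulrA.
Qed.

Lemma crossing_inj mu U U' : crossing mu U -> crossing mu U' -> U = U'.
Proof.
by move=> c c'; have := crossing_nat c c' (Hom1 hN mu); rewrite (sh1 hlam) mul1r mulr1.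
Qed.

(** Composites of members of [X] decompose in [X], which supplies enough test intertwiners
    [s * tau s' * w] and reduces the claim to [braid_fusion]. *)
Lemma crossing_comp
  (XX : forall rho sigma, X rho -> X sigma -> Sigma N X (rho \o sigma)) mu U mu' U' :
  crossing mu U -> crossing mu' U' -> crossing (mu \o mu') (mu U' * U).
Proof.
move=> c c'; case: (c) (c') => hm NU [U1 U2] sm hU [hm' NU' [U1' U2'] sm' hU'].
have uW : unitary_op (mu U' * U).
  split; rewrite (adjM hN) // -(shJ hm) // -!mulrA.
    by rewrite (mulrA (mu _)) -(shM hm) // U1' (sh1 hm) mul1r.
  by rewrite (mulrA U) U2 mul1r -(shM hm) // U2' (sh1 hm).
have sW : separated (mu \o mu').
  move=> phi x y hphi xy; apply: (sm phi) => // tau s Xt hs.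
  have Ns := HomI hs; have ht := hX Xt.
  apply: (sm' (phi \o tau)) => [|tau' s' Xt' hs' /=].
    exact: star_hom_comp hphi ht.
  have Ns' := HomI hs'; have ht' := hX Xt'.
  apply: (Sigma_separated (XX _ _ Xt Xt') hphi) => sigma w Xs hw.
  have Nw := HomI hw.
  rewrite -!mulrA -!(shM hphi) // !mulrA; apply: (xy sigma) => //.
  apply: (Hom_mul hN _ hw); split=> [|a Na /=]; first by alg_mem.
  by rewrite -mulrA -(shM ht) // (HomE hs') // (shM ht) // mulrA (HomE hs) // mulrA.
have hmm := star_hom_comp hm hm'.
split=> // tau s Xt hs; have Ns := HomI hs; have htau := hX Xt.
have NE := braid_base_in Xt; have [_ [E1 E2]] := hE (Sigma_base Xt).
have NW : N (mu U' * U) by alg_mem.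
set W := mu U' * U in uW NW *.
(* Separation tests by multiplying from the right with intertwiners, so the claim is first turned
   into one ending in [lam s^†]; unitarity of [W] and [E tau] leads back. *)
suff : s^† * W = E tau * lam s^†.
  move=> /(congr1 (@adj _ _)).
  rewrite [(s^† * W)^†](adjM hN) // [(E _ * _)^†](adjM hN) //.
  rewrite (adjK hN) // -(shJ hlam) // (adjK hN) //.
  move=> /(congr1 (fun x => W * (x * E tau))).
  by rewrite -(mulrA (lam s)) E1 mulr1 -(mulrA W^†) (mulrA W) (proj2 uW) mul1r.
apply: (sm lam _ _ hlam) => ta m Xta hm1.
have [Nm hta] := (HomI hm1, hX Xta).
apply: (sm' (lam \o ta)) => [|ta' m' Xta' hm2 /=].
  exact: star_hom_comp hlam hta.
have [Nm' hta'] := (HomI hm2, hX Xta').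
apply: (Sigma_separated (XX _ _ Xta Xta') hlam) => sigma w Xs hw.
have [Nw hs'] := (HomI hw, hX Xs).
(* Both ends lie in [X], so naturality moves this composite through the braiding, whatever [mu] and
   [mu'] are. *)
have hz : Hom N N sigma tau (s^† * (m * ta m' * w)).
  apply: (Hom_mul hN (Hom_adj hN hN htau _ hs)) => //.
  apply: (Hom_mul hN _ hw); split=> [|a Na /=]; first by alg_mem.
  by rewrite -mulrA -(shM hta) // (HomE hm2) // (shM hta) // mulrA (HomE hm1) // mulrA.
have NEs := braid_base_in Xta'; have NEt := braid_base_in Xta.
have -> : s^† * W * lam m * lam (ta m') * lam w = s^† * (m * ta m' * w) * E sigma.
  rewrite -!mulrA (braid_fusion Xs Xta Xta' hw) /W.
  rewrite -!mulrA (mulrA U) (hU _ _ Xta hm1).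
  rewrite -!mulrA (mulrA (mu _) m) -(HomE hm1) // -!mulrA (mulrA (E ta)).
  have [hEta _] := hE (Sigma_base Xta).
  rewrite (HomE (is_braid_Hom he Sl (Sigma_base Xta) hEta)) //=.
  rewrite -!mulrA (mulrA (ta U')) -(shM hta) // (hU' _ _ Xta' hm2).
  by rewrite (shM hta) // !mulrA.
rewrite -(mulrA (E tau)) -!(shM hlam) // -!(mulrA (E tau)) -!(shM hlam) //.
rewrite (crossing_nat (Sigma_crossing (Sigma_base Xs))
  (Sigma_crossing (Sigma_base Xt)) hz).
by rewrite !mulrA.
Qed.

End Crossing.
End Braiding.

(** * Decomposition into irreducibles *)

Section Decomposition.
Context {R : realType} {H : hilbertSpace R} {M : set (bop H)}.
Hypothesis hM : star_algebra M.
Implicit Types (beta sigma : endo H) (w p z : bop H).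
#[local] Hint Extern 0 (M _) => alg_mem : core.

(** By irreducibility [w^† * w] is a scalar [c], positive because [w x] has positive norm for some
    [x]; [w] is then divided by the square root of [c]. *)
Lemma irreducible_normalize beta sigma w :
  star_hom M M beta -> irreducible M M beta -> star_hom M M sigma ->
  Hom M M beta sigma w -> w != 0 -> exists2 k, k != 0 & isometry_op (k *: w).
Proof.
move=> hb ib hs hw w0; have Mw := HomI hw.
have : Hom M M beta beta (w^† * w) := Hom_mul hM (Hom_adj hM hM hb hs hw) hw.
rewrite ib /scalar_op => -[c cE].
have [x wx0] : exists x, w x != 0.
  apply: contrapT => wx0; case/negP: w0; apply/eqP/bopP => x.
  by apply/eqP/negPn/negP => wx; apply: wx0; exists x.
have x0 : x != 0.
  by apply: contraNneq wx0 => ->; rewrite bop_apply0.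
have c0 : 0 < c.
  have : inner H (w x) (w x) = c^* * inner H x x.
    rewrite (adjointableP (alg_adjointable hM Mw)) -bop_mulE cE bop_scaleE.
    by rewrite linearZr_LR.
  have x1 : inner H x x != 0 by rewrite dnorm_eq0.
  move=> /esym/(canRL (mulfK x1)) e.
  by rewrite lt0r -conjC_ge0 -conjC_eq0 e -lt0r divr_gt0 // dnorm_gt0.
exists (sqrtC c)^-1; first by rewrite invr_eq0 sqrtC_eq0 gt_eqF.
have sc : 0 < sqrtC c by rewrite sqrtC_gt0.
rewrite /isometry_op (adjZ hM) // bop_scalerAl bop_scalerAr cE !scalerA.
rewrite geC0_conj ?invr_ge0 ?ltW // -[X in _ * X]sqrtCK expr2 mulrA -(mulrA _ _^-1).
by rewrite mulVf ?gt_eqF // mulr1 mulVf ?gt_eqF // scale1r.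
Qed.

(** * Orthonormal families of intertwiners *)

Section Frames.
Variables (Phi : set (endo H)) (sigma : endo H).
Hypothesis hs : star_hom M M sigma.
Hypothesis hPhi : forall beta, Phi beta -> star_hom M M beta.

(* [p] is the range projection of an orthonormal family of intertwiners. *)
Definition frame_proj p := exists n (e : 'I_n -> bop H) (gam : 'I_n -> endo H),
  [/\ forall i, Phi (gam i), forall i, Hom M M (gam i) sigma (e i),
      forall i j, (e i)^† * e j = (i == j)%:R & p = \sum_i e i * (e i)^†].

Lemma frame_proj0 : frame_proj 0.
Proof.
by exists 0%N, (fun=> 0), (fun=> sigma); split; [case|case|case|rewrite big_ord0].
Qed.

Lemma frame_proj_Sigma : frame_proj 1 -> Sigma M Phi sigma.
Proof.
move=> [n [e [gam [Pg he e1 p1]]]]; exists n, e, gam; split=> //; split=> //.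
move=> a Ma; rewrite -[LHS]mulr1 p1 mulr_sumr; apply: eq_bigr => i _.
by rewrite mulrA (HomE (he i)).
Qed.

Lemma frame_proj_idem p : frame_proj p -> p * p = p.
Proof.
move=> [n [e [gam [_ _ e1 pE]]]]; rewrite {1}pE mulr_suml [RHS]pE.
apply: eq_bigr => i _; rewrite -mulrA pE mulr_sumr (bigD1 i) //= big1 => [|j ji].
  by rewrite mulrA e1 eqxx mul1r addr0.
by rewrite mulrA e1 eq_sym (negbTE ji) mul0r.
Qed.

(** The condition [p' * p = p] says that the range only grows, so that absorbing further operators
    loses none of the earlier ones. *)
Definition absorbable z := forall p, frame_proj p ->
  exists p', [/\ frame_proj p', p' * p = p & p' * z = z].

(** Gram-Schmidt step: the part [w'] of [w] orthogonal to the frame is again an intertwiner, and if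
    nonzero it is normalized and adjoined. [Phi beta] is asked only for [w != 0] because a vanishing
    component says nothing about [beta]. *)
Lemma absorb_intertwiner beta w :
  star_hom M M beta -> irreducible M M beta -> Hom M M beta sigma w ->
  (w != 0 -> Phi beta) -> absorbable w.
Proof.
move=> hb ib hw Pb p hp; case: (hp) => n [e [gam [Pg he e1 pE]]].
have Me i := HomI (he i); have Mw := HomI hw.
have hg i := hPhi (Pg i).
have ep i : (e i)^† * p = (e i)^†.
  rewrite pE mulr_sumr (bigD1 i) //= big1 => [|j ji].
    by rewrite mulrA e1 eqxx mul1r addr0.
  by rewrite mulrA e1 eq_sym (negbTE ji) mul0r.
have Mp : M p by rewrite pE.
have hp' : Hom M M sigma sigma p.
  split=> // a Ma; rewrite pE mulr_suml mulr_sumr; apply: eq_bigr => i _.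
  rewrite -mulrA (HomE (Hom_adj hM hM (hg i) hs (he i))) // mulrA.
  by rewrite (HomE (he i)) // mulrA.
pose w' := w - p * w.
have ew' i : (e i)^† * w' = 0 by rewrite mulrBr mulrA ep subrr.
have [w0|w0] := eqVneq w' 0.
  exists p; split=> //; first exact: frame_proj_idem.
  by apply/eqP; rewrite eq_sym -subr_eq0; apply/eqP.
have hw' : Hom M M beta sigma w'.
  split=> [|a Ma]; first by rewrite /w'.
  by rewrite mulrBl mulrBr (HomE hw) // -mulrA (HomE hw) // !mulrA (HomE hp').
have Mw' := HomI hw'.
have [k k0 kw] := irreducible_normalize hb ib hs hw' w0.
have Pb' : Phi beta.
  by apply: Pb; apply: contraNneq w0 => w0; rewrite /w' w0 mulr0 subrr.
pose f := k *: w'; have Mf : M f by rewrite /f.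
have ef i : (e i)^† * f = 0 by rewrite bop_scalerAr ew' scaler0.
have fe i : f^† * e i = 0.
  by rewrite -[e i](adjK hM) // -(adjM hM) // ef adj0.
have pf : p * f = 0 by rewrite pE mulr_suml big1 // => i _; rewrite -mulrA ef mulr0.
have fp : f^† * p = 0 by rewrite pE mulr_sumr big1 // => i _; rewrite mulrA fe mul0r.
have pp := frame_proj_idem hp.
exists (f * f^† + p); split.
(* The new isometry sits at index 0, the old frame behind it. *)
- exists n.+1, (fun i => oapp e f (unlift ord0 i)).
  exists (fun i => oapp gam beta (unlift ord0 i)).
  split.
  + by move=> i /=; case: unliftP => [j|] _ /=; [exact: Pg|exact: Pb'].
  + move=> i /=; case: unliftP => [j|] _ //=; split=> // a Ma.
    by rewrite /f bop_scalerAl (HomE hw') // bop_scalerAr.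
  + move=> i j /=; case: unliftP => [i'|] ->; case: unliftP => [j'|] -> //=.
  + rewrite big_ord_recl unlift_none /= pE; congr (_ + _).
    by apply: eq_bigr => i _; rewrite liftK.
- by rewrite mulrDl -mulrA fp mulr0 add0r pp.
- have wE : w = k^-1 *: f + p * w by rewrite /f scalerA mulVf // scale1r subrK.
  have ffpw : f * f^† * (p * w) = 0 by rewrite -mulrA (mulrA _^†) fp mul0r mulr0.
  have ff : f^† * f = 1 := kw.
  clearbody f; rewrite [in LHS]wE mulrDr !mulrDl ffpw add0r mulrA pp.
  by rewrite !bop_scalerAr pf scaler0 addr0 -mulrA ff mulr1 -wE.
Qed.

Lemma absorb_all n (z : 'I_n -> bop H) p :
  (forall i, absorbable (z i)) -> frame_proj p ->
  exists p', [/\ frame_proj p', p' * p = p & forall i, p' * z i = z i].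
Proof.
move=> hz hp; suff [p' [fp pp zs]] : exists p', [/\ frame_proj p', p' * p = p &
    forall i, i \in enum 'I_n -> p' * z i = z i].
  by exists p'; split=> // i; apply: zs; rewrite mem_enum.
elim: (enum 'I_n) => [|i s [p1 [f1 pp1 z1]]].
  by exists p; split=> //; exact: frame_proj_idem.
have [p2 [f2 pp2 z2]] := hz i p1 f1; exists p2; split=> [//||j].
  by rewrite -pp1 mulrA pp2.
by rewrite inE => /orP[/eqP -> //|/z1 <-]; rewrite mulrA pp2.
Qed.

End Frames.
End Decomposition.

(** * Alpha-induction and half-braidings *)

Section AlphaInduction.
Context {R : realType} {H : hilbertSpace R} {N M : set (bop H)} {iotab : endo H}.
Context {X : set (endo H)} {eps : endo H -> endo H -> bop H}.
Hypotheses (hN : star_algebra N) (hM : star_algebra M) (hNM : N `<=` M).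
Hypothesis hX : forall rho, X rho -> star_hom N N rho.
Hypothesis hXid : X id.
Hypothesis hXX : forall rho sigma, X rho -> X sigma -> Sigma N X (rho \o sigma).
Hypothesis he : braiding N X eps.
Hypothesis hiotab : star_hom M N iotab.
Hypothesis Stheta : Sigma N X (theta iotab).
Context {v r : bop H} {c : R[i]}.
Hypotheses (hv : Hom M M id iotab v) (v1 : v^† * v = 1).
Hypotheses (Nr : N r) (c0 : c != 0) (rv : r^† * v = c *: (1 : bop H)).
Implicit Types (b : bool) (lam mu nu rho beta : endo H) (m n x y Y U : bop H).
#[local] Hint Extern 0 (N _) => alg_mem : core.
#[local] Hint Extern 0 (M _) => alg_mem : core.

Local Notation theta := (theta iotab).
Local Notation E := (braiding_pm N X eps).
Local Notation al := (alpha N M iotab X eps).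

Definition crosses b lam mu U := @crossing R H N X lam (E b lam) mu U.

(** [x] is recovered as [v^† * iotab x * v]. *)
Lemma iotab_inj x y : M x -> M y -> iotab x = iotab y -> x = y.
Proof.
move=> Mx My xy; have := HomE hv Mx; rewrite /= xy -(HomE hv My) /=.
by move/(congr1 (fun z => v^† * z)); rewrite !mulrA v1 !mul1r.
Qed.

Let coef m := c^-1 *: (r^† * iotab m).

Let coef_in m : M m -> N (coef m).
Proof. by move=> Mm; rewrite /coef. Qed.

(** Since [v] intertwines [id] and [iotab], [r^† * iotab m * v = r^† * v * m = c *: m]. Intertwining
    relations on [M] need therefore be checked only on [N] and on [v]. *)
Lemma coefE m : M m -> m = coef m * v.
Proof.
move=> Mm; rewrite /coef bop_scalerAl -mulrA -(HomE hv Mm) mulrA rv.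
by rewrite bop_scalerAl mul1r scalerA mulVf // scale1r.
Qed.

(** * Alpha-induction of one morphism *)

Section Fixed.
Context {b : bool} {lam : endo H}.
Hypothesis Sl : Sigma N X lam.
Let hE mu (Sm : Sigma N X mu) := braiding_pmP hN hX hXid b he Sl Sm.
Let hlam : star_hom N N lam := Sigma_star_hom hN hX Sl.
Let heb := signed_braidingP hN hX b he.

Lemma crosses_Sigma mu : Sigma N X mu -> crosses b lam mu (E b lam mu).
Proof. exact: (Sigma_crossing hN hX Sl hE). Qed.

Lemma crosses_comp mu U mu' U' : crosses b lam mu U -> crosses b lam mu' U' ->
  crosses b lam (mu \o mu') (mu U' * U).
Proof. exact: (crossing_comp hN hX heb Sl hE hXX). Qed.

Lemma crosses_nat mu U mu' U' Y : crosses b lam mu U -> crosses b lam mu' U' ->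
  Hom N N mu mu' Y -> Y * U = U' * lam Y.
Proof. exact: (crossing_nat hN hX Sl). Qed.

Lemma crosses_inj mu U U' : crosses b lam mu U -> crosses b lam mu U' -> U = U'.
Proof. exact: (crossing_inj hN hX Sl). Qed.

Local Notation u := (E b lam theta).

Let cu : crosses b lam theta u := crosses_Sigma Stheta.
Let Nu : N u := crossing_in cu.
Let uu : unitary_op u := crossing_unitary cu.

Let hth : star_hom N N theta := Sigma_star_hom hN hX Stheta.

(** [iotab v] intertwines [theta] and [theta \o theta] on [N]; the right side crosses the two copies
    of [theta] one after the other. *)
Lemma crosses_v : iotab v * u = theta u * u * lam (iotab v).
Proof.
apply: (crosses_nat cu (crosses_comp cu cu)); split=> // n Nn /=.
rewrite /Defs.theta /iotaNM /= -!(shM hiotab) //; try alg_mem.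
by rewrite (HomE hv).
Qed.

(** This makes alpha-induction well defined: without a preimage the [xget] in [alpha] would return
    0. *)
Lemma alpha_preimage m : M m -> exists x, M x /\ iotab x = u * lam (iotab m) * u^†.
Proof.
move=> Mm; have [Nc [u1 u2]] := (coef_in Mm, uu).
(* The witness is forced by [m = coef m * v]: the extension must be [lam] on [N] and send [v] to
   [u^† * v]. *)
exists (lam (coef m) * (u^† * v)); split; first by [].
rewrite [in RHS](coefE Mm) !(shM hiotab) // (shM hlam) //.
have -> : iotab (lam (coef m)) = u * lam (iotab (coef m)) * u^†.
  have hu := is_braid_Hom hN hX heb Sl Stheta (proj1 (hE Stheta)).
  by rewrite (HomE hu Nc) /= -mulrA u2 mulr1.

have iv : iotab v = theta u * u * lam (iotab v) * u^†.
  by rewrite -crosses_v -mulrA u2 mulr1.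
have tu : iotab u^† * theta u = 1.
  by rewrite -[theta u]/(iotab u) -(shM hiotab) // u1 (sh1 hiotab).
by rewrite [in LHS]iv !mulrA -(mulrA _ (iotab _)) tu mulr1 -(mulrA _ u^†) u1 mulr1.
Qed.

Lemma alphaP m : M m ->
  M (al b lam m) /\ iotab (al b lam m) = u * lam (iotab m) * u^†.
Proof. by move=> Mm; apply: (xgetPex 0 (alpha_preimage Mm)). Qed.

Lemma alpha_eq m x : M m -> M x -> iotab x = u * lam (iotab m) * u^† -> al b lam m = x.
Proof.
by move=> Mm Mx xE; have [Ma aE] := alphaP Mm; apply: iotab_inj; rewrite // xE.
Qed.

Lemma alpha_star_hom : star_hom M M (al b lam).
Proof.
have [u1 u2] := uu; have I m (Mm : M m) := proj1 (alphaP Mm).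
have J m (Mm : M m) := proj2 (alphaP Mm).
split=> //; split=> [z m n Mm Mn|m n Mm Mn||m Mm].
- have [Im In] := (I _ Mm, I _ Mn); apply: alpha_eq => //.
  rewrite !(shP hiotab) // !J // (shP hlam) // mulrDr mulrDl.
  by rewrite bop_scalerAr bop_scalerAl.
- have [Im In] := (I _ Mm, I _ Mn); apply: alpha_eq => //.
  rewrite !(shM hiotab) // !J // (shM hlam) // !mulrA.
  by rewrite -(mulrA _ u^†) u1 mulr1.
- by apply: alpha_eq => //; rewrite (sh1 hiotab) (sh1 hlam) mulr1 u2.
- have Im := I _ Mm; apply: alpha_eq => //.
  rewrite !(shJ hiotab) // J // (shJ hlam) // !(adjM hN) // (adjK hN) //.
  by rewrite mulrA.
Qed.

Lemma alphaN n : N n -> al b lam n = lam n.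
Proof.
move=> Nn; have [u1 u2] := uu; apply: alpha_eq; rewrite //.
have hu := is_braid_Hom hN hX heb Sl Stheta (proj1 (hE Stheta)).
by rewrite (HomE hu Nn) /= -mulrA u2 mulr1.
Qed.

(* [iotab Y] intertwines [theta mu] and [theta mu'], so this is naturality of
   the braiding pulled back along the injection [iotab]. *)
Lemma alpha_nat mu U mu' U' Y : crosses b lam mu U -> crosses b lam mu' U' ->
  M Y -> (forall n, N n -> Y * mu n = mu' n * Y) -> Y * U = U' * al b lam Y.
Proof.
move=> cm cm' MY hY; have [hm hm'] := (crossing_hom cm, crossing_hom cm').
have [NU NU'] := (crossing_in cm, crossing_in cm').
have [u1 u2] := uu; have [Ma aE] := alphaP MY.
apply: iotab_inj; rewrite // !(shM hiotab) // aE !mulrA.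
have := crosses_nat (crosses_comp cu cm) (crosses_comp cu cm') (Y := iotab Y).
rewrite mulrA => e; rewrite -e; last first.
  split=> // n Nn; rewrite /Defs.theta /iotaNM /= -!(shM hiotab) ?hY //; alg_mem.
by rewrite -mulrA u2 mulr1.
Qed.

End Fixed.
Lemma alpha_v b lam : Sigma N X lam -> E b lam theta * al b lam v = v.
Proof.
move=> Sl; have hal := alpha_star_hom (b := b) Sl.
have cu := crosses_Sigma (b := b) Sl Stheta; have Nu := crossing_in cu.
have [u1 u2] := crossing_unitary cu; have hlam := Sigma_star_hom hN hX Sl.
have [Ma aE] := alphaP (b := b) Sl (HomI hv).
apply: iotab_inj; rewrite // (shM hiotab) // aE !mulrA.
by have := crosses_v (b := b) Sl => /= <-; rewrite -mulrA u2 mulr1.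
Qed.

(** Checked on [N], where it is the braiding relation, and on [v]. The sign [b'] is free because
    only the fact that [al b' nu] is a homomorphism extending [nu] enters; the sign of [lam] must
    match the braiding operator. *)
Lemma alpha_swap b b' lam nu : Sigma N X lam -> Sigma N X nu ->
  Hom M M (al b lam \o al b' nu) (al b' nu \o al b lam) (E b lam nu).
Proof.
move=> Sl Sn; have hal := alpha_star_hom (b := b) Sl.
have han := alpha_star_hom (b := b') Sn.
have [hl hn] := (Sigma_star_hom hN hX Sl, Sigma_star_hom hN hX Sn).
have cn := crosses_Sigma (b := b) Sl Sn; have ct := crosses_Sigma (b := b) Sl Stheta.
have [NE [E1 E2]] := (crossing_in cn, crossing_unitary cn).
have [Nu [u1 u2]] := (crossing_in ct, crossing_unitary ct).
have hN' n : N n ->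
    E b lam nu * al b lam (al b' nu n) = al b' nu (al b lam n) * E b lam nu.
  move=> Nn; rewrite (alphaN Sn) // (alphaN Sl) // (alphaN Sl) // (alphaN Sn) //.
  have hE := is_braid_Hom hN hX (signed_braidingP hN hX b he) Sl Sn
    (proj1 (braiding_pmP hN hX hXid b he Sl Sn)).
  by rewrite (HomE hE Nn).
have Mv := HomI hv.
have hv' : E b lam nu * al b lam (al b' nu v) = al b' nu (al b lam v) * E b lam nu.
  (* [al b' nu v] intertwines [nu] and [nu \o theta] on [N]; by [alpha_v] the unitary
     [nu (E b lam theta)] then appears on both sides and cancels. *)
  have := alpha_nat (b := b) Sl cn (crosses_comp Sl cn ct) (Y := al b' nu v).
  rewrite -mulrA => e.
  have {e}e : al b' nu v * E b lam nu =
      nu (E b lam theta) * (E b lam nu * al b lam (al b' nu v)).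
    apply: e => // n Nn /=; have Nt := shI (Sigma_star_hom hN hX Stheta) Nn.
    rewrite -(alphaN (b := b') Sn Nn) -(alphaN (b := b') Sn Nt) -!(shM han) //.
    by rewrite (HomE hv) //; apply: hNM.
  have := congr1 (fun z => nu (E b lam theta)^† * z) e.
  rewrite [RHS]mulrA -(shM hn) // u1 (sh1 hn) mul1r => <-.
  rewrite -[in LHS](alpha_v b Sl) (shM han) // (alphaN Sn) //.
  by rewrite !mulrA -(shM hn) // u1 (sh1 hn) mul1r.
split=> // m Mm /=; have Nc := coef_in Mm.
rewrite (coefE Mm) (shM han) // (shM hal) // (shM hal) // (shM han) //.
by rewrite mulrA hN' // -mulrA hv' mulrA.
Qed.

Local Notation al2 nu nu' := (al true nu \o al false nu').
Local Notation iso := (alpha_isometry N M iotab X eps).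
Local Notation hb := (half_braid_op N M iotab X eps).

(** * The half-braiding operators *)

Section HalfBraiding.
Context {b : bool} {lam : endo H}.
Hypothesis Sl : Sigma N X lam.
Let hal : star_hom M M (al b lam) := alpha_star_hom Sl.

Section Pair.
Context {nu nu' : endo H}.
Hypotheses (Xn : X nu) (Xn' : X nu').

Lemma alpha2_star_hom : star_hom M M (al2 nu nu').
Proof. by apply: star_hom_comp; apply/alpha_star_hom/(Sigma_base hN). Qed.

Lemma alpha2N n : N n -> al2 nu nu' n = nu (nu' n).
Proof.
move=> Nn /=; have [hn' Sn] := (hX Xn', Sigma_base hN Xn).
by rewrite (alphaN (Sigma_base hN Xn')) // (alphaN Sn) //; alg_mem.
Qed.

Lemma crosses2 : crosses b lam (nu \o nu') (E b lam (nu \o nu')).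
Proof. exact: (crosses_Sigma Sl (hXX Xn Xn')). Qed.

(** By uniqueness of crossings the braiding with [nu \o nu'] factors into those with [nu] and [nu'],
    and [alpha_swap] covers both signs. *)
Lemma alpha2_swap :
  Hom M M (al b lam \o al2 nu nu') (al2 nu nu' \o al b lam) (E b lam (nu \o nu')).
Proof.
have [Sn Sn'] := (Sigma_base hN Xn, Sigma_base hN Xn').
have [hn hn'] := (hX Xn, hX Xn').
have [c1 c2] := (crosses_Sigma (b := b) Sl Sn, crosses_Sigma (b := b) Sl Sn').
have [N1 N2] := (crossing_in c1, crossing_in c2).
have han := alpha_star_hom (b := true) Sn.
have han' := alpha_star_hom (b := false) Sn'.
rewrite (crosses_inj Sl crosses2 (crosses_comp Sl c1 c2)).
split=> // m Mm /=.
rewrite -mulrA (HomE (alpha_swap b true Sl Sn)) //= mulrA.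
rewrite -(alphaN (b := true) Sn N2) -(shM han) //.
rewrite (HomE (alpha_swap b false Sl Sn')) //= (shM han) ?mulrA //.
Qed.

End Pair.

Section OneBeta.
Context {beta nu nu' : endo H} {T : bop H}.
Hypotheses (hbeta : star_hom M M beta) (isoT : iso beta nu nu' T).

Let Xn : X nu. Proof. by case: isoT. Qed.
Let Xn' : X nu'. Proof. by case: isoT. Qed.
Let hT : Hom M M beta (al2 nu nu') T. Proof. by case: isoT. Qed.
Let T1 : T^† * T = 1. Proof. by case: isoT. Qed.
Let h2 : star_hom M M (al2 nu nu') := alpha2_star_hom Xn Xn'.
Let MT : M T := HomI hT.
Let ME : M (E b lam (nu \o nu')). Proof. exact/hNM/(crossing_in (crosses2 Xn Xn')). Qed.
Let hT' : Hom M M (al2 nu nu') beta T^† := Hom_adj hM hM hbeta h2 hT.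

Lemma half_braid_in : M (hb b lam nu nu' T).
Proof. by rewrite /half_braid_op. Qed.

(** [Y * T^†] intertwines [nu \o nu'] and [mu] on [N], so [alpha_nat] applies to it and
    [T^† * T = 1] removes [T]. The right side is free of [T], whence the independence of choices; a
    general [mu] allows composites later. *)
Lemma half_braid_nat mu U Y : crosses b lam mu U -> M Y ->
  (forall n, N n -> Y * beta n = mu n * Y) -> Y * hb b lam nu nu' T = U * al b lam Y.
Proof.
move=> cm MY hY; have MU : M U := hNM (crossing_in cm).
have MYT : M (Y * T^†) by [].
rewrite /half_braid_op !mulrA.
rewrite (alpha_nat Sl (crosses2 Xn Xn') cm MYT) => [|n Nn].
  by rewrite -mulrA -(shM hal) // -mulrA T1 mulr1.
have hn' := hX Xn'; rewrite -[(nu \o nu') n]/(nu (nu' n)) -(alpha2N Xn Xn') //.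
by rewrite -mulrA (HomE hT') ?mulrA ?hY //; apply: hNM.
Qed.

Lemma half_braidE : T * hb b lam nu nu' T = E b lam (nu \o nu') * al b lam T.
Proof.
apply: half_braid_nat (crosses2 Xn Xn') MT _ => n Nn.
by rewrite (HomE hT) ?(alpha2N Xn Xn') //; apply: hNM.
Qed.

Lemma half_braid_indep xi xi' S : iso beta xi xi' S ->
  hb b lam nu nu' T = hb b lam xi xi' S.
Proof.
case=> Xx Xx' hS S1; have MS := HomI hS.
have ME' : M (E b lam (xi \o xi')) by exact/hNM/(crossing_in (crosses2 Xx Xx')).
have := half_braid_nat (crosses2 Xx Xx') MS => /= e.
rewrite -[LHS]mul1r -S1 -mulrA e ?mulrA // => n Nn.
by rewrite (HomE hS) ?(alpha2N Xx Xx') //; apply: hNM.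
Qed.

(** One product follows from [half_braidE]; for the other, [alpha_nat] moves the range projection
    [T * T^†] through the braiding. *)
Lemma half_braid_unitary : unitary_op (hb b lam nu nu' T).
Proof.
have [E1 E2] := crossing_unitary (crosses2 Xn Xn').
have Mhb := half_braid_in; have e := half_braidE.
have e' : hb b lam nu nu' T = T^† * (E b lam (nu \o nu') * al b lam T).
  by rewrite /half_braid_op mulrA.
have Mal := shI hal MT; have eJ : (hb b lam nu nu' T)^† =
    al b lam T^† * ((E b lam (nu \o nu'))^† * T).
  by rewrite e' !(adjM hM) // (adjK hM) // (shJ hal) // mulrA.
split; first by rewrite eJ -!mulrA e (mulrA _^†) E1 mul1r -(shM hal) // T1 (sh1 hal).
rewrite eJ e' -!mulrA (mulrA (al b lam T)) -(shM hal) //.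
rewrite (mulrA (E _ _ _) (al _ _ _)).
have hTT : forall n, N n -> T * T^† * (nu \o nu') n = (nu \o nu') n * (T * T^†).
  move=> n Nn; rewrite -[(nu \o nu') n]/(nu (nu' n)) -(alpha2N Xn Xn') //.
  by rewrite -mulrA (HomE hT') ?mulrA ?(HomE hT) //; apply: hNM.
have MTT : M (T * T^†) by [].
rewrite -(alpha_nat Sl (crosses2 Xn Xn') (crosses2 Xn Xn') MTT hTT).
by rewrite -!mulrA (mulrA (E _ _ _)) E2 mul1r T1 mulr1 T1.
Qed.

Lemma half_braid_Hom :
  Hom M M (al b lam \o beta) (beta \o al b lam) (hb b lam nu nu' T).
Proof.
split=> [|m Mm /=]; first exact: half_braid_in.
rewrite /half_braid_op -!mulrA -(shM hal) // (HomE hT) //= (shM hal) //; last first.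
  by apply: (shI h2).
rewrite [E _ _ _ * _]mulrA (HomE (alpha2_swap Xn Xn')) //= !mulrA.
by have /= -> := HomE hT' (shI hal Mm).
Qed.

End OneBeta.

(** Both sides are compared after multiplication by an isometry [W] from [beta1 \o beta2] into the
    product of the two pairs of alpha-inductions. *)
Lemma half_braid_mul beta1 beta2 beta3 nu1 nu1' nu2 nu2' nu3 nu3' T1 T2 T3 Y :
  star_hom M M beta1 -> star_hom M M beta2 -> star_hom M M beta3 ->
  iso beta1 nu1 nu1' T1 -> iso beta2 nu2 nu2' T2 -> iso beta3 nu3 nu3' T3 ->
  Hom M M beta3 (beta1 \o beta2) Y ->
  Y * hb b lam nu3 nu3' T3 =
  beta1 (hb b lam nu2 nu2' T2) * hb b lam nu1 nu1' T1 * al b lam Y.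
Proof.
move=> h1 h2 h3 i1 i2 i3 hY.
have [[X1 X1' hT1 iT1] [X2 X2' hT2 iT2]] := (i1, i2).
have [g1 g2] := (alpha2_star_hom X1 X1', alpha2_star_hom X2 X2').
have [[M1 M2] MY] := ((HomI hT1, HomI hT2), HomI hY).
have [Mh1 Mh2] := (half_braid_in h1 i1, half_braid_in h2 i2).
have [c1 c2] := (crosses2 X1 X1', crosses2 X2 X2').
have ME1 := hNM (crossing_in c1); have ME2 := hNM (crossing_in c2).
have hn1 := crossing_hom c1.
have E12 := alpha2N X1 X1' (crossing_in c2).
pose W := al2 nu1 nu1' T2 * T1.
have MW : M W by apply: (algM hM) => //; apply: (shI g1).
have W1 : W^† * W = 1.
  rewrite /W (adjM hM) //.
  rewrite -(shJ g1) // -mulrA (mulrA (al2 _ _ _)) -(shM g1) // iT2 (sh1 g1).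
  by rewrite mul1r.
have hWY n : N n -> W * Y * beta3 n = (nu1 \o nu1') ((nu2 \o nu2') n) * (W * Y).
  move=> Nn; have Mn := hNM Nn.
  have Nn2 : N ((nu2 \o nu2') n) by apply: (shI (crossing_hom c2)).
  rewrite -mulrA (HomE hY) //= /W mulrA -!(mulrA (al2 _ _ T2)) -!mulrA.
  have M2n := shI h2 Mn; rewrite (mulrA T1) (HomE hT1) // mulrA mulrA -(shM g1) //.
  rewrite (HomE hT2) // (shM g1) ?(alpha2N X2 X2') //.
  by rewrite (alpha2N X1 X1') // !mulrA.
have MWY : M (W * Y) by [].
(* On [N], [W * Y] maps into the composite of all four morphisms, whose crossing is the product of
   the two braidings. *)
have e := half_braid_nat h3 i3 (crosses_comp Sl c1 c2) MWY hWY.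
rewrite -[LHS]mul1r -[RHS]mul1r -W1 -!(mulrA W^†); congr (_ * _).
rewrite mulrA e -[(nu1 \o nu1') _]/(nu1 (nu1' _)) -E12.
have Mg := shI g1 M2; have Mal2 := shI hal M2.
(* The braidings are traded for half-braidings by [half_braidE], first at [T2], then at [T1]. *)
rewrite /W -(mulrA _ T1 Y) (shM hal) // !mulrA -(mulrA _ _ (al b lam (al2 _ _ T2))).
rewrite (HomE (alpha2_swap X1 X1')) //= mulrA -(shM g1) // -(half_braidE h2 i2).
rewrite (shM g1) // (shM hal) // !mulrA -(mulrA _ _ (al b lam T1)).
rewrite -(half_braidE h1 i1) !mulrA -(mulrA _ _ T1).
by rewrite -(HomE hT1) // !mulrA.
Qed.

End HalfBraiding.
(** Lets a single alpha-induction be read as a product of a positive and a negative one. *)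
Lemma alpha_id b m : M m -> al b id m = m.
Proof.
move=> Mm; have Sid := Sigma_base hN hXid.
suff u1 : E b id theta = 1.
  by apply: (alpha_eq Sid) => //; rewrite u1 adj1 mul1r mulr1.
have Sth := Sigma_separated hN hX Stheta.
apply: (Sth id) => // tau s Xt hs.
have [_ e2 e3 _] := signed_braidingP hN hX b he.
rewrite mul1r; have [_ h] := proj1 (braiding_pmP hN hX hXid b he Sid Stheta).
have := h _ _ _ _ hXid Xt (Hom1 hN id) hs.
by rewrite mul1r (sh1 (hX Xt)) mulr1 e2 // mulr1.
Qed.

(** On [v] this is naturality of the braiding with [theta], combined with [alpha_v]. *)
Lemma Hom_alpha b lam mu t : Sigma N X lam -> Sigma N X mu ->
  Hom N N lam mu t -> Hom M M (al b lam) (al b mu) t.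
Proof.
move=> Sl Sm ht; have [Nt Mt] := (HomI ht, hNM (HomI ht)); split=> // m Mm.
have [hl hm] := (alpha_star_hom (b := b) Sl, alpha_star_hom (b := b) Sm).
have [cl cm] := (crosses_Sigma (b := b) Sl Stheta, crosses_Sigma (b := b) Sm Stheta).
have [[N1 [u1 u2]] [N2 [w1 w2]]] := ((crossing_in cl, crossing_unitary cl),
  (crossing_in cm, crossing_unitary cm)).
have [Nc Mv] := (coef_in Mm, HomI hv).
have tv : t * al b lam v = al b mu v * t.
  have := is_braid_natl hN hX Sl Sm Stheta
    (proj1 (braiding_pmP hN hX hXid b he Sl Stheta))
    (proj1 (braiding_pmP hN hX hXid b he Sm Stheta)) ht.
  move=> /(congr1 (fun z => (E b mu theta)^† * (z * al b lam v))).
  rewrite -!mulrA (mulrA _^†) w1 mul1r (alpha_v b Sl) => ->.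
  have := HomE hv Mt; rewrite /Defs.theta /= => <-.
  by rewrite -[in LHS](alpha_v b Sm) !mulrA w1 mul1r.
rewrite (coefE Mm) (shM hl) // (shM hm) // (alphaN Sl) // (alphaN Sm) //.
by rewrite mulrA (HomE ht) // -mulrA tv mulrA.
Qed.

(** [al b lam v] is the image of an isometry, so for [lam] in [X] it embeds [al b lam] into a
    morphism that decomposes in [XM]. *)
Lemma Hom_alpha_v b lam : Sigma N X lam ->
  Hom M M (al b lam) (iotaNM \o lam \o iotab) (al b lam v).
Proof.
move=> Sl; have [hl hal] := (Sigma_star_hom hN hX Sl, alpha_star_hom (b := b) Sl).
have Mv := HomI hv; split=> [|m Mm]; first by alg_mem.
rewrite -(shM hal) // (HomE hv) // (shM hal) //.
by rewrite (alphaN Sl).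
Qed.

(** * Decomposition of alpha-inductions and the half-braiding property *)

Section Representatives.
Context {XM : set (endo H)}.
Hypothesis hXM : MM_representatives M iotab X XM.
Local Notation Phi := (MM_alpha N M iotab X eps XM).

Lemma MM_alpha_star_hom beta : Phi beta -> star_hom M M beta.
Proof. by case=> XMb _; have [h _ _ _ _] := hXM; case: (h _ XMb) => -[]. Qed.

Lemma subsector_alpha2 b lam beta : X lam -> star_hom M M beta ->
  subsector M M beta (al b lam) -> exists nu nu',
  [/\ X nu, X nu' & subsector M M beta (al2 nu nu')].
Proof.
move=> Xl hb [t ht t1]; have hal := alpha_star_hom (b := b) (Sigma_base hN Xl).
case: b ht hal => ht hal; [exists lam, id|exists id, lam]; split=> //;
  exists t => //; split=> [|m Mm /=]; try exact: (HomI ht).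
  by rewrite (alpha_id false) // (HomE ht).
by rewrite (alpha_id true) ?(HomE ht) //; apply: (shI hal).
Qed.

(** Compressing the components [s j] of [rho i \o iotab] by [al b (rho i) v] yields intertwiners
    [x j] into [al b (rho i)], which [t i] carries into [al b lam]. A frame absorbing them all has
    projection 1. *)
Lemma alpha_Sigma b lam : Sigma N X lam -> Sigma M Phi (al b lam).
Proof.
move=> Sl; have hal := alpha_star_hom (b := b) Sl.
case: (Sl) => n [t [rho [Xr ht]]]; case: (ht) => Nt _ t1 _.
have ht' i := is_sum_Hom ht i.
apply: frame_proj_Sigma.
have abst i : absorbable (M := M) Phi (al b lam) (t i).
  move=> p hp; have Sr := Sigma_base hN (Xr i).
  have har := alpha_star_hom (b := b) Sr.
  have hri := hX (Xr i).
  have [hXM1 _ _ _ /(_ _ (Xr i))[_ [m [s [beta [XMb hs]]]]]] := hXM.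
  have hb j : star_hom M M (beta j) by case: (hXM1 _ (XMb j)) => -[].
  have hs' j := is_sum_Hom hs j; case: (hs) => Ms _ s1 _.
  have hiri : star_hom M M (iotaNM \o rho i \o iotab).
    have hinc : star_hom N M iotaNM by split=> // a; exact: hNM.
    exact: (star_hom_comp (star_hom_comp hinc hri) hiotab).
  have hw := Hom_adj hM hM har hiri (Hom_alpha_v b Sr).
  have Mw := HomI hw.
  have Mav : M (al b (rho i) v) := HomI (Hom_alpha_v b Sr).
  pose x j := (al b (rho i) v)^† * s j.
  have hx j : Hom M M (beta j) (al b (rho i)) (x j) := Hom_mul hM hw (hs' j).
  have hz j := Hom_mul hM (Hom_alpha b Sr Sl (ht' i)) (hx j).
  have [p' [fp pp zp]] : exists p', [/\ frame_proj (M := M) Phi (al b lam) p',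
      p' * p = p &
      forall j, p' * (t i * x j) = t i * x j].
    apply: (absorb_all _ hp) => j.
    have [_ irr] := hXM1 _ (XMb j).
    apply: (absorb_intertwiner hM hal MM_alpha_star_hom (hb j) irr (hz j)) => z0.
    (* A nonzero [x j] is a multiple of an isometry, so [beta j] is a subsector of [al b (rho i)]
       and belongs to [Phi]. *)
    have x0 : x j != 0 by apply: contraNneq z0 => ->; rewrite mulr0.
    split=> //; have [k k0 kx] := irreducible_normalize hM (hb j) irr har (hx j) x0.
    apply: (subsector_alpha2 (b := b) (Xr i) (hb j)); exists (k *: x j) => //.
    have Mx := HomI (hx j); split=> // a Ma.
    by rewrite bop_scalerAl (HomE (hx j)) // bop_scalerAr.
  exists p'; split=> //.
  (* Inserting [\sum_j s j * (s j)^† = 1] between [al b (rho i) v] and its adjoint expresses [t i]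
     through the absorbed operators. *)
  have tE : t i = \sum_j t i * x j * ((s j)^† * al b (rho i) v).
    transitivity (t i * (al b (rho i) v)^† * (\sum_j s j * (s j)^†) * al b (rho i) v).
      have Mv := HomI hv.
      by rewrite s1 mulr1 -mulrA -(shJ har) // -(shM har) // v1 (sh1 har) mulr1.
    rewrite mulr_sumr mulr_suml; apply: eq_bigr => j _.
    by rewrite /x !mulrA.
  by rewrite tE mulr_sumr; apply: eq_bigr => j _; rewrite [LHS]mulrA zp.
(* The process starts from the empty frame; [\sum_i t i * (t i)^† = 1] forces the final projection
   to be 1. *)
have [p [fp _ tp]] := absorb_all abst (frame_proj0 Phi (al b lam)).
suff -> : 1 = p by [].
rewrite -[RHS]mulr1 -{1 2}t1 mulr_sumr; apply: eq_bigr => i _.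
by rewrite mulrA tp.
Qed.

Lemma alpha_half_braiding b lam : Sigma N X lam ->
  half_braiding M Phi (al b lam) (half_braid_family N M iotab X eps b lam).
Proof.
move=> Sl.
(* The family picks an unspecified isometry, which exists by the definition of [Phi]; the rest holds
   for any choice. *)
have hbf beta : Phi beta -> exists nu nu' T, iso beta nu nu' T /\
    half_braid_family N M iotab X eps b lam beta = hb b lam nu nu' T.
  move=> [_ [nu [nu' [Xn Xn' [T hT T1]]]]].
  apply: (@xgetPex _ 0 [set u | exists nu nu' T,
    iso beta nu nu' T /\ u = hb b lam nu nu' T]).
  by exists (hb b lam nu nu' T), nu, nu', T.
split=> [|beta Pb|b1 b2 b3 Y P1 P2 P3 hY]; first exact: alpha_Sigma.
  have [nu [nu' [T [isoT ->]]]] := hbf _ Pb; have h := MM_alpha_star_hom Pb.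
  by split; [exact: (half_braid_unitary Sl h isoT)|exact: (half_braid_Hom Sl h isoT)].
have [[n1 [n1' [T1 [i1 ->]]]] [n2 [n2' [T2 [i2 ->]]]]] := (hbf _ P1, hbf _ P2).
have [n3 [n3' [T3 [i3 ->]]]] := hbf _ P3.
by apply: (half_braid_mul Sl _ _ _ i1 i2 i3 hY); exact: MM_alpha_star_hom.
Qed.

End Representatives.
End AlphaInduction.

(** * Nonvanishing of the statistical dimension *)

Lemma pimsner_popa_le1 (R : realType) (H : hilbertSpace R) (B P : set (bop H)) (c : R) :
  B 1 -> (1 : bop H) <> 0 -> pimsner_popa_constants B P c -> c <= 1.
Proof.
move=> B1 n0 [c0 [E [[_ [_ _ E1 _ _]] cE]]].
have [x x0] : exists x : H, x != 0.
  apply: contrapT => x0; apply: n0; apply: bopP => x.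
  by apply/eqP/negPn/negP => wx; apply: x0; exists x.
(* The inequality is evaluated at the identity operator, which [E] fixes. *)
have /(_ x) : op_le (c%:C%C *: (1 : bop H)) 1.
  by rewrite -{2}E1; apply: cE => // y; rewrite subr0 dnorm_ge0.
have -> : 1 - c%:C%C *: (1 : bop H) = (1 - c%:C%C) *: (1 : bop H).
  by rewrite scalerBl scale1r.
rewrite bop_scaleE linearZl_LR /= pmulr_lge0 ?dnorm_gt0 // subr_ge0.
by rewrite -(rmorph1 (real_complex R)) lecR.
Qed.

(** The bound by 1 makes [sup] a genuine upper bound of the constants, hence positive; on an
    unbounded set it would be a default value. *)
Lemma statistical_dim_neq0 (R : realType) (H : hilbertSpace R) (A B : set (bop H))
    (rho : endo H) :
  B 1 -> (1 : bop H) <> 0 -> morphism A B rho -> statistical_dim A B rho != 0.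
Proof.
move=> B1 n0 [_ [c hc]]; rewrite /statistical_dim sqrtr_eq0 -ltNge invr_gt0.
case: (hc) => c0 _; apply: (lt_le_trans c0).
apply: ub_le_sup hc; exists 1 => d; exact: pimsner_popa_le1.
Qed.

Theorem lemma3p1 (R : realType) (H : hilbertSpace R) (N M : set (bop H))
    (iotab : endo H) (X Y XM : set (endo H)) (eps : endo H -> endo H -> bop H)
    (hN : type_III_factor N) (hM : type_III_factor M) (hNM : N `<=` M)
    (hincl : morphism N M iotaNM) (hiotab : conjugate N M iotaNM iotab)
    (hX : finite_system N X) (heps : braiding N X eps)
    (hY : finite_system N Y) (hYX : Y `<=` X)
    (htheta : Sigma N Y (theta iotab))
    (hXM : MM_representatives M iotab X XM)
    (b : bool) (lam : endo H) (hlam : Sigma N X lam) :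
  (forall (beta nu nu' xi xi' : endo H) (T S : bop H),
     MM_alpha N M iotab X eps XM beta ->
     alpha_isometry N M iotab X eps beta nu nu' T ->
     alpha_isometry N M iotab X eps beta xi xi' S ->
     half_braid_op N M iotab X eps b lam nu nu' T =
     half_braid_op N M iotab X eps b lam xi xi' S) /\
  half_braiding M (MM_alpha N M iotab X eps XM)
    (alpha N M iotab X eps b lam)
    (half_braid_family N M iotab X eps b lam).
Proof.
have [[vN _ _] _] := hN; have [[vM n0 _] _] := hM.
have {vN} sN := von_neumann_star_algebra vN.
have {vM} sM := von_neumann_star_algebra vM.
(* As [iotaNM] is the identity, [v] is an isometry in [Hom M M id iotab] and the conjugate equation
   says that [r^† * v] is the inverse dimension. *)
have [[hib _] [r [v [[[Nr _] _] [hv v1] rv _]]]] := hiotab.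
have d0 := statistical_dim_neq0 (alg1 sM) n0 hincl.
have [_ hX1 _ [Xid _ XX]] := hX.
have hXs rho (Xr : X rho) : star_hom N N rho by case: (hX1 _ Xr) => -[].
have Sth : Sigma N X (theta iotab).
  by case: htheta => n [t [rho [Yr hs]]]; exists n, t, rho; split=> // i; exact: hYX.
have c0 : ((statistical_dim N M iotaNM)^-1)%:C%C != 0 by rewrite fmorph_eq0 invr_eq0.
split; last first.
  exact: (alpha_half_braiding sN sM hNM hXs Xid XX heps hib Sth hv v1 Nr c0 rv hXM).
move=> beta nu nu' xi xi' T S Pb iT iS.
exact: (half_braid_indep sN sM hNM hXs Xid XX heps hib Sth hv v1 Nr c0 rv hlam
  (MM_alpha_star_hom hXM Pb) iT iS).
Qed.
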